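(* Let $d\ge 1$ be a constant and $\epsilon\in(0,1)$. Every metric space $(X,\delta)$ of doubling dimension $d$ (with $X$ finite) has a $(1+\epsilon)$-spanner with lightness $\tilde{O}(\epsilon^{-(d+2)})$.
   Context: The doubling dimension of a metric space $(X,\delta)$ is the smallest $d$ such that every ball can be covered by at most $2^d$ balls of half its radius. A $(1+\epsilon)$-spanner of $(X,\delta)$ is a graph $S$ on vertex set $X$, each edge $\{x,y\}$ weighted $\delta(x,y)$, with $d_S(x,y)\le(1+\epsilon)\delta(x,y)$ for all $x,y\in X$; its lightness is its total edge weight divided by the weight of a minimum spanning tree of the complete graph on $X$ with weights $\delta$. $\tilde{O}$ suppresses a $\log(1/\epsilon)$ factor; the hidden constant may depend on $d$. *)

(* Defs.v *)
From HB Require Import structures.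
From mathcomp Require Import all_boot all_order all_algebra.
From mathcomp Require Import all_classical all_reals all_analysis.

Set Implicit Arguments.
Unset Strict Implicit.
Unset Printing Implicit Defensive.

Import Order.TTheory GRing.Theory Num.Theory.
Import numFieldNormedType.Exports.

Local Open Scope classical_set_scope.
Local Open Scope ring_scope.

#[short(type="finMetricType")]
HB.structure Definition FinMetric (K : numDomainType) :=
  { X of Finite X & Metric K X }.

Section Doubling.
Context {R : realType} (X : finMetricType R).

(* Library balls are open. On a finite space every open ball of positive radius
   is a closed ball of slightly smaller radius, and conversely with a slightly
   larger radius, so closed balls would give the same property. *)
Definition half_ball_cover (d : R) : Prop :=
  forall (x : X) (r : R), 0 < r ->
    exists A : {set X}, #|A|%:R <= 2 `^ d /\
      ball x r `<=` \bigcup_(c in [set` A]) ball c (r / 2).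

(* [d] need not be an integer: this is the base-2 logarithm of the doubling
   constant. *)
Definition doubling_dimension (d : R) : Prop :=
  half_ball_cover d /\ forall d' : R, half_ball_cover d' -> d <= d'.

End Doubling.

Section Graphs.
Context {R : realType} (X : finMetricType R).
Implicit Types (S T : rel X) (x y : X).

Definition simple_graph S : Prop := symmetric S /\ irreflexive S.

(* Each edge {x, y} is counted as (x, y) and as (y, x), hence the half. *)
Definition graph_weight S : R :=
  2^-1 * \sum_(x : X) \sum_(y : X | S x y) mdist x y.

(* Weight of the walk visiting [x] and then the vertices of [p] in order. *)
Definition walk_weight x (p : seq X) : R := \sum_(w <- pairmap mdist x p) w.

(* +oo when [x] and [y] are not connected in [S]. *)
Definition graph_dist S x y : \bar R :=
  ereal_inf [set (walk_weight x p)%:E | p in [set p | path S x p /\ last x p = y]].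

Definition is_spanner (t : R) S : Prop :=
  simple_graph S /\
  forall x y, (graph_dist S x y <= (t * mdist x y)%:E)%E.

Definition connected_graph S : Prop := forall x y, connect S x y.

Definition acyclic_graph S : Prop :=
  forall c : seq X, (2 < size c)%N -> ~ ucycle S c.

Definition spanning_tree T : Prop :=
  [/\ simple_graph T, connected_graph T & acyclic_graph T].

(* The infimum is attained, see [mst_weight_attained]. *)
Definition mst_weight : R := inf [set graph_weight T | T in spanning_tree].

Definition lightness S : R := graph_weight S / mst_weight.

Lemma star_spanning_tree (x0 : X) :
  spanning_tree (fun x y => (x != y) && ((x == x0) || (y == x0))).
Proof.
split.
- by split=> [x y|x]; rewrite ?eqxx// eq_sym orbC.
- set T := (T in connected_graph T).
  have cx0 x : connect T x0 x.
    have [->|nx] := eqVneq x x0; first exact: connect0.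
    by apply: connect1; rewrite /T eq_sym nx eqxx.
  have c0x x : connect T x x0.
    have [->|nx] := eqVneq x x0; first exact: connect0.
    by apply: connect1; rewrite /T nx eqxx orbT.
  by move=> x y; apply: connect_trans (c0x x) (cx0 y).
- case=> [|a [|b [|c s]]]//= _ /andP[/=].
  move=> /and3P[/andP[_ ab] /andP[_ bc] cs] /and3P[].
  rewrite !inE !negb_or => /and3P[nab nac nas] /andP[nbc nbs] ncs.
  have bx0 : b == x0.
    apply: contraT => nb; move: ab bc nac.
    by rewrite (negbTE nb) orbF /= => /eqP-> /eqP->; rewrite eqxx.
  have cx0 : c != x0 by rewrite -(eqP bx0) eq_sym.
  case: s nas nbs ncs cs => [|e s] /=.
    by move=> _ _ _; rewrite (negbTE cx0) -(eqP bx0) (negbTE nab) andbF.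
  rewrite !inE !negb_or => _ /andP[nbe _] _.
  by rewrite (negbTE cx0) -(eqP bx0) [e == b]eq_sym (negbTE nbe) andbF.
Qed.

Lemma mst_weight_attained (x0 : X) :
  exists T, [/\ spanning_tree T, mst_weight = graph_weight T &
    forall T', spanning_tree T' -> graph_weight T <= graph_weight T'].
Proof.
pose rel_of (E : {set X * X}) : rel X := fun x y => (x, y) \in E.
pose set_of (T : rel X) : {set X * X} := [set u | T u.1 u.2]%SET.
have rel_ofK T : rel_of (set_of T) = T.
  by apply/funext => x; apply/funext => y; rewrite /rel_of inE.
pose P E := `[< spanning_tree (rel_of E) >].
have [E0 PE0] : exists E, P E.
  exists (set_of (fun x y => (x != y) && ((x == x0) || (y == x0)))).
  by apply/asboolP; rewrite rel_ofK; exact: star_spanning_tree.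
case: (arg_minP (fun E => graph_weight (rel_of E)) PE0) => E /asboolP PE minE.
have min T' : spanning_tree T' -> graph_weight (rel_of E) <= graph_weight T'.
  by move=> ?; rewrite -[T']rel_ofK; apply: minE; apply/asboolP; rewrite rel_ofK.
exists (rel_of E); split=> //; apply/eqP; rewrite eq_le; apply/andP; split.
  apply: ge_inf; last by exists (rel_of E).
  by exists (graph_weight (rel_of E)) => _ [T' /min ? <-].
apply: lb_le_inf; first by exists (graph_weight (rel_of E)), (rel_of E).
by move=> _ [T' /min ? <-].
Qed.

End Graphs.

(* Main.v *)
Require Import Defs.
From HB Require Import structures.
From mathcomp Require Import all_boot all_order all_algebra.
From mathcomp Require Import all_classical all_reals all_analysis.
From mathcomp Require Import lra zify.

Set Implicit Arguments.
Unset Strict Implicit.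
Unset Printing Implicit Defensive.

Import Order.TTheory GRing.Theory Num.Theory.
Import numFieldNormedType.Exports.

Local Open Scope classical_set_scope.
Local Open Scope ring_scope.

(* Let [T] be a minimum spanning tree of weight [W] and let [S] be [T] together
   with the edges [A] added by the greedy algorithm with stretch [1 + eps]. The
   edges of [A] are grouped by length into scales [[r, 2 r)], and the scales
   into [O(1 + ln (1 / eps))] classes, in each of which consecutive scales differ
   by a factor at least [192 / eps].

   Within a class, a rooted tree of walks of [S] is carried from small to large
   scales. It starts as [T], its weight never increases, and before scale [r]
   every point is within [eps r / 32] of one of its vertices. At scale [r],
   leaves are first pruned to depth about [eps r], which pays for the leaves, and
   hence for the branching vertices, that remain. Let then [(u, v)] be an edge of
   scale [r], [a] and [b] tree vertices close to [u] and [v], and [b] not below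
   [a]. If the chain of parents of [a] meets no branching vertex over length
   [5 r], hang [a] from [b] and drop the part of the chain that became
   superfluous: it is either longer than [5 r] or a walk from [a] to [b], of
   length about [(1 + eps) r] at least by the greedy rule, so that the weight
   decreases by [eps r / 2] or more.

   The remaining edges of scale [r] end close to a dropped chain or to a vertex
   within [5 r] below a branching vertex or an earlier shortcut. Such places are
   covered by [O(1 / eps)] balls of radius [eps r / 8] each, and by packing a
   ball meets [O(eps `^ (- d))] edges of the scale. So the weight of the edges of
   scale [r] is [O(eps `^ (- (d + 2)))] times the weight lost, up to terms that
   sum geometrically over the class. *)

Section Near.
Context {R : realType} {X : finMetricType R}.
Implicit Types (G : rel X) (x y z : X) (p : seq X) (t : R).

Definition near_in G x y t : Prop :=
  exists p, [/\ path G x p, last x p = y & walk_weight x p <= t].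

Lemma walk_weight_cons x y p :
  walk_weight x (y :: p) = mdist x y + walk_weight y p.
Proof. by rewrite /walk_weight /= big_cons. Qed.

Lemma walk_weight_cat x p q :
  walk_weight x (p ++ q) = walk_weight x p + walk_weight (last x p) q.
Proof.
elim: p x => [|y p IH] x /=; first by rewrite {2}/walk_weight big_nil add0r.
by rewrite !walk_weight_cons IH addrA.
Qed.

Lemma mdist_walk x p : mdist x (last x p) <= walk_weight x p.
Proof.
elim: p x => [|y p IH] x /=; first by rewrite /walk_weight big_nil mdistxx.
by rewrite walk_weight_cons (le_trans (metric_triangle _ y _))// lerD2l.
Qed.

Lemma near_refl G x t : 0 <= t -> near_in G x x t.
Proof. by move=> t0; exists [::]; rewrite /walk_weight big_nil. Qed.

Lemma near_edge G x y : G x y -> near_in G x y (mdist x y).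
Proof.
move=> xy; exists [:: y]; rewrite /= xy walk_weight_cons.
by rewrite /walk_weight big_nil addr0.
Qed.

Lemma near_trans G y x z t t' :
  near_in G x y t -> near_in G y z t' -> near_in G x z (t + t').
Proof.
move=> [p [xp py pt]] [q [yq qz qt]]; exists (p ++ q).
by rewrite cat_path last_cat xp py yq qz walk_weight_cat py lerD.
Qed.

Lemma near_le G x y t t' : t <= t' -> near_in G x y t -> near_in G x y t'.
Proof. by move=> tt' [p [? ? pt]]; exists p; split=> //; exact: le_trans tt'. Qed.

Lemma near_sub G G' x y t :
  subrel G G' -> near_in G x y t -> near_in G' x y t.
Proof. by move=> GG' [p [xp ? ?]]; exists p; split=> //; exact: sub_path xp. Qed.

Lemma near_sym G x y t : symmetric G -> near_in G x y t -> near_in G y x t.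
Proof.
move=> Gsym [p [xp <- pt]]; apply: near_le pt _ => {t}.
elim: p x xp => [|z p IH] x /=.
  by move=> _; apply: near_refl; rewrite /walk_weight big_nil.
move=> /andP[xz /IH zp]; rewrite walk_weight_cons addrC.
by apply: near_trans zp _; rewrite metric_sym; apply: near_edge; rewrite Gsym.
Qed.

Lemma mdist_near G x y t : near_in G x y t -> mdist x y <= t.
Proof. by move=> [p [_ <- ]]; apply: le_trans; exact: mdist_walk. Qed.

Lemma near_ge0 G x y t : near_in G x y t -> 0 <= t.
Proof. by move/mdist_near; apply: le_trans; exact: mdist_ge0. Qed.

Lemma walk_weight_ge0 x p : 0 <= walk_weight x p.
Proof. exact: le_trans (mdist_ge0 _ _) (mdist_walk x p). Qed.

Lemma near_light G x y t : near_in G x y t ->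
  near_in [rel a b | G a b && (mdist a b <= t)] x y t.
Proof.
move=> [p [xp py pt]]; exists p; split=> //.
elim: p x xp pt {py} => //= z p IH x /andP[-> zp].
rewrite walk_weight_cons => pt; apply/andP; split=> /=.
  by apply: le_trans pt; rewrite lerDl walk_weight_ge0.
by apply: IH => //; apply: le_trans pt; rewrite lerDr mdist_ge0.
Qed.

Lemma near_graph_dist G x y t :
  near_in G x y t -> (graph_dist G x y <= t%:E)%E.
Proof.
move=> [p [xp py pt]]; apply: (@le_trans _ _ (walk_weight x p)%:E).
  by apply: ereal_inf_lbound; exists p.
by rewrite lee_fin.
Qed.

End Near.

Section RootedTrees.
Context {X : finType}.
Implicit Types (V : {set X}) (par : X -> X) (x y rt : X).

Definition rooted rt V par : Prop :=
  [/\ rt \in V, par rt = rt, forall x, x \in V -> par x \in V &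
      forall x, x \in V -> exists n, iter n par x = rt].

Definition children rt V par x : {set X} :=
  [set y in V | (y != rt) && (par y == x)]%SET.

Lemma iter_root rt V par n : rooted rt V par -> iter n par rt = rt.
Proof. by move=> [_ prt _ _]; elim: n => //= n ->. Qed.

Lemma iter_par_in rt V par n x : rooted rt V par -> x \in V -> iter n par x \in V.
Proof. by move=> [_ _ Vpar _] xV; elim: n => //= n; exact: Vpar. Qed.

Lemma iter_cycle_root rt V par x n : rooted rt V par -> x \in V ->
  iter n.+1 par x = x -> x = rt.
Proof.
move=> rV xV cyc; have [_ _ _ /(_ x xV) [m mx]] := rV.
have cyck k : iter (k * n.+1) par x = x.
  by elim: k => // k IH; rewrite mulSn iterD IH.
by rewrite -(cyck m) mulnS addnC iterD mx (iter_root _ rV).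
Qed.

Lemma descendants_antisym rt V par x y m n : rooted rt V par ->
  x \in V -> y \in V -> iter m par x = y -> iter n par y = x -> x = y.
Proof.
move=> rV xV yV xy yx; have [k] : exists k, k = (n + m)%N by eexists.
case: k => [|k] knm; first by move: xy; have -> : m = 0%N by lia.
have xrt : x = rt.
  by apply: (iter_cycle_root (n := k) rV xV); rewrite knm iterD xy.
by rewrite -xy xrt (iter_root _ rV).
Qed.

Lemma sum_children rt V par : rooted rt V par ->
  (\sum_(x in V) #|children rt V par x| = #|V|.-1)%N.
Proof.
move=> [rtV _ Vpar _].
have -> : #|V|.-1 = #|(V :\ rt)%SET| by rewrite (cardsD1 rt V) rtV.
rewrite -[RHS]sum1_card [RHS](partition_big par [in V])/=; last first.
  by move=> y; rewrite !inE => /andP[_]; exact: Vpar.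
apply: eq_bigr => x xV; rewrite -sum1_card; apply: eq_bigl => y.
by rewrite !inE andbA [(y != rt) && _]andbC.
Qed.

(* Pointwise, [c + 2 <= 2 c + 2 [c = 0]] if [c >= 2] and [2 <= 2 c + 2 [c = 0]]
   otherwise; sum over the numbers [c] of children, whose total is [#|V| - 1]. *)
Lemma card_branching_children rt V par : rooted rt V par ->
  (#|[set y in V | (y != rt) && (1 < #|children rt V par (par y)|)]%SET| <=
   2 * #|[set x in V | #|children rt V par x| == 0]%SET|)%N.
Proof.
move=> rV; have [rtV _ Vpar _] := rV; set c := fun x => #|children rt V par x|.
have V0 : (0 < #|V|)%N by apply/card_gt0P; exists rt.
have -> : (#|[set y in V | (y != rt) && (1 < c (par y))]%SET| =
    \sum_(x in V) (if 1 < c x then c x else 0))%N.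
  rewrite -sum1_card (partition_big par [in V])/=; last first.
    by move=> y; rewrite !inE => /andP[/Vpar].
  apply: eq_bigr => x xV; case: ifPn => cx.
    rewrite sum1_card; apply: eq_card => y; rewrite unfold_in /= !inE.
    by case: (par y =P x) => [->|_]; rewrite ?cx ?andbT ?andbF.
  rewrite big_pred0// => y; rewrite !inE.
  by case: (par y =P x) => [->|_]; rewrite ?(negbTE cx) ?andbF.
have -> : #|[set x in V | c x == 0]%SET| = (\sum_(x in V) (c x == 0))%N.
  by rewrite -sum1_card big_mkcond [RHS]big_mkcond; apply: eq_bigr => x _;
    rewrite inE; case: (x \in V); case: eqP.
have := sum_children rV; rewrite -/c => sumc.
suff : (\sum_(x in V) (if 1 < c x then c x else 0) + \sum_(x in V) 2 <=
    2 * \sum_(x in V) (c x == 0) + 2 * \sum_(x in V) c x)%N.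
  by rewrite sumc sum_nat_const; lia.
rewrite !big_distrr -!big_split/=; apply: leq_sum => x _.
by case: (c x) => [|[|k]] //=; lia.
Qed.

End RootedTrees.

Section Covers.
Context {R : realType} {X : finMetricType R}.
Implicit Types (G : rel X) (x y : X).

Lemma cover_height G (I : finType) (Y : {set I}) (f : I -> X) (h : I -> R)
    (L s : R) :
  symmetric G -> 0 < s -> 0 <= L -> (forall i, i \in Y -> 0 <= h i <= L) ->
  (forall i j, i \in Y -> j \in Y -> h i <= h j ->
     near_in G (f j) (f i) (h j - h i)) ->
  exists Z : seq X, (size Z)%:R <= L / s + 1 /\
    forall i, i \in Y -> exists2 c, c \in Z & near_in G (f i) c s.
Proof.
move=> Gsym s0 L0 hL hY; pose N := Num.truncn (L / s).
pose c m := [pick i in Y | Num.truncn (h i / s) == m].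
exists (map f (pmap c (iota 0 N.+1))); split.
  have szN : (size (pmap c (iota 0 N.+1)) <= N.+1)%N.
    by rewrite size_pmap (leq_trans (count_size _ _))// size_iota.
  apply: (@le_trans _ _ N.+1%:R); first by rewrite size_map ler_nat.
  have /Num.Theory.truncn_itv/andP[NL _] : 0 <= L / s by rewrite divr_ge0// ltW.
  by rewrite -natr1 lerD2r.
move=> y yY; have /andP[hy0 hyL] := hL y yY.
have y0 : 0 <= h y / s by rewrite divr_ge0// ltW.
have /andP[ty1 ty2] := Num.Theory.truncn_itv y0.
case E : (c (Num.truncn (h y / s))) => [z|]; last first.
  by move: E; rewrite /c; case: pickP => // /(_ y); rewrite yY eqxx.
have [zY zt] : z \in Y /\ Num.truncn (h z / s) = Num.truncn (h y / s).
  by move: E; rewrite /c; case: pickP => // z' /andP[z'Y /eqP z't] [<-].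
have /andP[hz0 _] := hL z zY.
have z0 : 0 <= h z / s by rewrite divr_ge0// ltW.
have /andP[tz1 tz2] := Num.Theory.truncn_itv z0.
rewrite zt in tz1 tz2; set m := (Num.truncn (h y / s)) in ty1 ty2 tz1 tz2 E.
move: ty1 tz1; rewrite !ler_pdivlMr// => ty1 tz1.
move: ty2 tz2; rewrite !ltr_pdivrMr// -natr1 mulrDl mul1r => ty2 tz2.
exists (f z).
  rewrite map_f// mem_pmap; apply/mapP; exists m => //.
  rewrite mem_iota /= add0n ltnS; apply: Num.Theory.le_truncn.
  by rewrite ler_pM2r// invr_gt0.
have [hzy|hyz] := leP (h z) (h y).
  by apply: near_le (hY _ _ zY yY hzy); lra.
by apply: near_le (near_sym Gsym (hY _ _ yY zY (ltW hyz))); lra.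
Qed.

End Covers.

Section Chains.
Context {R : realType} {X : finMetricType R}.
Implicit Types (G : rel X) (V : {set X}) (par : X -> X) (l : X -> R).
Implicit Types (x y rt : X).

Definition chain_weight par l x n : R := \sum_(j < n) l (iter j par x).

Lemma chain_weightD par l x m n :
  chain_weight par l x (m + n) =
  chain_weight par l x m + chain_weight par l (iter m par x) n.
Proof.
rewrite /chain_weight big_split_ord /=; congr (_ + _).
by apply: eq_bigr => j _; rewrite addnC iterD.
Qed.

Lemma near_chain G (F : pred X) par l x n :
  (forall y, F y -> near_in G y (par y) (l y)) ->
  (forall j, (j < n)%N -> F (iter j par x)) ->
  near_in G x (iter n par x) (chain_weight par l x n).
Proof.
move=> FG; elim: n => [|n IH] Fx; first by apply: near_refl; rewrite /chain_weight big_ord0.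
rewrite /chain_weight big_ord_recr /=; apply: near_trans (FG _ (Fx n _)) => //.
by apply: IH => j jn; apply: Fx; rewrite ltnW.
Qed.

(* Leaves are removed one at a time; [g y] bounds the depth of what has been
   removed below [y], and replacing [g (par x)] by the maximum of itself and
   [g x + l x] raises the sum of [g] by at most the weight [l x] saved. *)
Lemma prune_leaves G rt V par l (b : R) :
  rooted rt V par -> (forall x, x \in V -> near_in G x (par x) (l x)) ->
  symmetric G -> 0 <= b ->
  exists V' (g : X -> R), [/\ V' \subset V, rooted rt V' par,
    (forall x, x \in V' -> 0 <= g x),
    \sum_(x in V') g x + \sum_(x in V') l x <= \sum_(x in V) l x &
    (forall x, x \in V' -> x != rt -> #|children rt V' par x| = 0%N ->
       b < g x + l x) /\
    (forall x, x \in V -> exists2 y, y \in V' & near_in G x y b)].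
Proof.
move=> rV Vl Gsym b0.
suff : forall n (V1 : {set X}) (g1 : X -> R), (#|V1| <= n)%N -> V1 \subset V ->
    rooted rt V1 par -> (forall x, x \in V1 -> 0 <= g1 x <= b) ->
    exists V' (g : X -> R), [/\ V' \subset V1, rooted rt V' par,
    (forall x, x \in V' -> 0 <= g x <= b),
    \sum_(x in V') (g x + l x) <= \sum_(x in V1) (g1 x + l x) &
    (forall x, x \in V' -> x != rt -> #|children rt V' par x| = 0%N ->
       b < g x + l x) /\
    (forall z y, y \in V1 -> near_in G z y (g1 y) ->
       exists2 y', y' \in V' & near_in G z y' (g y'))].
  move=> /(_ #|V| V (fun=> 0)) [] // => [x _|V' [g [V'V rV' g0 gl [leaf cov]]]].
    by rewrite lexx.
  exists V', g; split=> //.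
  - by move=> x /g0 /andP[].
  - by move: gl; rewrite !big_split /= big1_eq add0r.
  - split=> // x xV; have [y yV' xy] := cov x x xV (near_refl _ _ (lexx _)).
    by exists y => //; apply: near_le xy; case/andP: (g0 _ yV').
elim=> [|n IH] V1 g1 V1n V1V rV1 g1b.
  by have [rtV1 _ _ _] := rV1; move: V1n; rewrite (cardsD1 rt) rtV1.
have [[x [xV1 xrt xleaf xb]]|noleaf] := pselect (exists x, [/\ x \in V1, x != rt,
    #|children rt V1 par x| = 0%N & g1 x + l x <= b]); last first.
  exists V1, g1; split=> //; split=> [x xV1 xrt xleaf|z y yV1 zy]; last by exists y.
  by rewrite ltNge; apply/negP => xb; apply: noleaf; exists x.
have [rtV1 prt V1par reach] := rV1.
have px : par x != x.
  by apply: contra_neq xrt => px; exact: (iter_cycle_root (n := 0) rV1 xV1).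
have xnear := Vl _ (fintype.subsetP V1V _ xV1).
have l0 := near_ge0 xnear.
have pV1 := V1par _ xV1.
pose V2 := (V1 :\ x)%SET.
pose g2 y := if y == par x then Num.max (g1 y) (g1 x + l x) else g1 y.
have pV2 : par x \in V2 by rewrite !inE px.
have V21 : V2 \subset V1 by exact: finset.subD1set.
have rV2 : rooted rt V2 par.
  split=> //; first by rewrite !inE eq_sym xrt.
  - move=> y; rewrite !inE => /andP[yx yV1]; rewrite V1par// andbT.
    have [->|yrt] := eqVneq y rt; first by rewrite prt eq_sym.
    apply/negP => pyx; have /eqP := xleaf.
    rewrite cards_eq0 => /eqP/setP/(_ y).
    by rewrite !inE yV1 yrt pyx.
  - by move=> y; rewrite !inE => /andP[_]; exact: reach.
have g2b y : y \in V2 -> 0 <= g2 y <= b.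
  move=> /(fintype.subsetP V21)/g1b /andP[y0 yb]; rewrite /g2.
  case: ifP => _; last by rewrite y0.
  by rewrite le_max y0 /= ge_max yb.
have [V' [g [V'V2 rV' gb gl [leaf cov]]]] : exists V' (g : X -> R),
    [/\ V' \subset V2, rooted rt V' par,
    (forall x, x \in V' -> 0 <= g x <= b),
    \sum_(x in V') (g x + l x) <= \sum_(x in V2) (g2 x + l x) &
    (forall x, x \in V' -> x != rt -> #|children rt V' par x| = 0%N ->
       b < g x + l x) /\
    (forall z y, y \in V2 -> near_in G z y (g2 y) ->
       exists2 y', y' \in V' & near_in G z y' (g y'))].
  apply: IH => //; last exact: fintype.subset_trans V1V.
  by move: V1n; rewrite (cardsD1 x) xV1 add1n ltnS.
have /andP[gx0 _] := g1b _ xV1; have /andP[gp0 _] := g1b _ pV1.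
exists V', g; split=> //.
- exact: fintype.subset_trans V21.
- apply: (le_trans gl); rewrite [leRHS](big_setD1 x)//= -/V2.
  rewrite [leLHS](big_setD1 (par x))//= [in leRHS](big_setD1 (par x))//=.
  rewrite addrA; apply: lerD.
    rewrite /g2 eqxx; set m := Num.max _ _.
    have : m <= g1 (par x) + (g1 x + l x).
      by rewrite ge_max; apply/andP; split; lra.
    by lra.
  apply: ler_sum => y; rewrite !inE => /andP[/negbTE yp _].
  by rewrite /g2 yp.
- split=> // z y yV1 zy; have [yx|yx] := eqVneq y x.
    apply: (cov z (par x)) => //; rewrite /g2 eqxx.
    rewrite yx in zy; apply: near_le (near_trans zy xnear).
    by rewrite le_max lexx orbT.
  apply: (cov z y); first by rewrite !inE yx.
  by apply: near_le zy; rewrite /g2; case: ifP => // _; rewrite le_max lexx.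
Qed.

End Chains.

Section Shortcut.
Context {R : realType} {X : finMetricType R}.
Implicit Types (G H : rel X) (V U : {set X}) (par : X -> X) (l : X -> R).
Implicit Types (x y a b rt : X) (Z : seq X).

Definition tree_in G rt V par l : Prop :=
  [/\ rooted rt V par, l rt = 0 & forall x, x \in V -> near_in G x (par x) (l x)].

(* [U] collects the vertices whose parent edge may no longer be shortcut, and
   [Z] the points near which the vertices removed so far are found. *)
Record shortcut_state G H (sig s D : R) rt V par l U Z : Prop := ShortcutState {
  st_tree : tree_in H rt V par l ;
  st_root : rt \in U ;
  st_sub : U \subset V ;
  st_fresh : forall x, x \in V -> x \notin U -> near_in G x (par x) (l x) /\
     forall y, y \in V -> y != rt -> par y = par x -> y = x ;
  st_cover : forall x, (exists2 y, y \in V & near_in G x y sig) \/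
     (exists2 c, c \in Z & near_in G x c (sig + s)) /\
     (exists2 y, y \in U & near_in G x y (sig + D)) }.

(* The parent edges from [a] up to [iter k.+1 par a] do not start in [U], so the
   interior vertices of this chain have no other children and can be dropped
   once [a] is hung from [b]; the result is a tree since [b] is not below [a]. *)
Lemma shortcut G H (sig s D : R) rt V par l U Z a b k (w : R) :
  symmetric G -> 0 < s -> 0 <= D ->
  shortcut_state G H sig s D rt V par l U Z ->
  b \in V -> (forall j, (j < k.+1)%N -> iter j par a \in V) ->
  (forall j, (j < k.+1)%N -> iter j par a \notin U) ->
  (forall j, (j < k.+1)%N -> iter j par a != b) ->
  (forall n, iter n par b != a) ->
  near_in H a b w -> chain_weight par l a k <= D ->
  exists V' par' l' U' Z', [/\ shortcut_state G H sig s D rt V' par' l' U' Z',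
    V' \subset V, forall x, x \in V' -> l' x <= Num.max (l x) w,
    (#|V' :\: U'| < #|V :\: U|)%N &
    [/\ \sum_(x in V') l' x <= \sum_(x in V) l x + w - chain_weight par l a k.+1,
        (#|U'| <= #|U| + 2)%N &
        (size Z')%:R <= (size Z)%:R + (D / s + 1) ]].
Proof.
move=> Gsym s0 D0 [[rV lrt Vl] rtU UV fresh cov] bV chV chU chb ndb ab chD.
have [rtV prt Vpar reach] := rV.
have aV : a \in V := chV 0%N isT.
have aU : a \notin U := chU 0%N isT.
have art : a != rt by apply: contraNneq aU => ->.
have notrt x : x \notin U -> x != rt by apply: contraNneq => ->.
have chinj i j : (i < j)%N -> (j < k.+1)%N -> iter i par a != iter j par a.
  move=> ij jk; apply/eqP => E; have ik : (i < k.+1)%N by apply: ltn_trans jk.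
  have /eqP := notrt _ (chU _ ik); apply.
  apply: (iter_cycle_root (n := (j - i).-1) rV (chV _ ik)).
  by rewrite -iterD prednK ?subn_gt0// subnK// ltnW.
pose Dr := [set iter i.+1 par a | i : 'I_k]%SET.
have DrP x : reflect (exists2 i, (i < k)%N & x = iter i.+1 par a) (x \in Dr).
  apply: (iffP imsetP) => [[i _ ->]|[i ik ->]]; first by exists i.
  by exists (Ordinal ik).
have DrU x : x \in Dr -> x \notin U by move=> /DrP[i ik ->]; exact: chU.
have aDr : a \notin Dr.
  by apply/DrP => -[i ik]; apply/eqP; exact: (chinj 0%N).
have bDr : b \notin Dr.
  by apply/DrP => -[i ik] E; have /eqP := chb i.+1 ik; apply.
have rtDr : rt \notin Dr by apply/negP => /DrU; rewrite rtU.
have DrV : Dr \subset V.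
  by apply/fintype.subsetP => x /DrP[i ik ->]; exact: chV.
pose V' := (V :\: Dr)%SET.
have V'P x : (x \in V') = (x \notin Dr) && (x \in V) by rewrite inE.
pose par' x := if x == a then b else par x.
pose l' x := if x == a then w else l x.
pose U' := (a |: (U :|: [set x in V' | (x \notin U) && (par x == b)]))%SET.
have U'P x : (x \in U') = [|| x == a, x \in U |
    [&& x \in V', x \notin U & par x == b]] by rewrite !inE.
have V'V : V' \subset V by exact: finset.subsetDl.
have chn (i j : nat) : (i + j < k.+1)%N ->
    near_in G (iter i par a) (iter (i + j) par a) (chain_weight par l (iter i par a) j).
  move=> ijk; rewrite addnC iterD.
  apply: (near_chain (F := [pred x | (x \in V) && (x \notin U)])) => [y /andP[yV yU]|].
    by have [] := fresh y yV yU.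
  move=> m mj; have mik : (m + i < k.+1)%N.
    by apply: leq_trans ijk; rewrite ltnS addnC leq_add2l ltnW.
  by rewrite -iterD; apply/andP; split; [exact: chV | exact: chU].
have chle i : (i <= k)%N -> chain_weight par l a i <= D.
  move=> ik; apply: le_trans chD; rewrite -[in leRHS](subnKC ik) chain_weightD.
  by rewrite lerDl; apply: near_ge0 (chn _ _ _); rewrite subnKC.
have [Z1 [szZ1 covZ1]] : exists Z1 : seq X, (size Z1)%:R <= D / s + 1 /\
    forall i : 'I_k, i \in [set: 'I_k]%SET ->
      exists2 c, c \in Z1 & near_in G (iter i.+1 par a) c s.
  apply: (@cover_height _ _ G 'I_k [set: 'I_k]%SET (fun i => iter i.+1 par a)
    (fun i => chain_weight par l a i.+1)) => //.
  - move=> i _; rewrite (near_ge0 (chn 0%N i.+1 (ltn_ord i))) /=.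
    exact: chle (ltn_ord i).
  - move=> i j _ _ hij; have [ij|ij] := leqP i j.
      have E : (i.+1 + (j - i))%N = j.+1 by rewrite addSn subnKC.
      rewrite -[in X in near_in _ X]E -[in X in near_in _ _ _ X]E chain_weightD.
      rewrite addrAC subrr add0r; apply: near_sym => //.
      by apply: chn; rewrite E ltnS.
    have E : (j.+1 + (i - j))%N = i.+1 by rewrite addSn subnKC// ltnW.
    have := chn j.+1 (i - j)%N; rewrite E => /(_ (ltn_ord i)) nr.
    have := near_ge0 nr; move: hij; rewrite -[in X in X <= _ -> _]E.
    rewrite -[in X in near_in _ _ _ X]E chain_weightD gerDl => ch0 ch1.
    by apply: near_le nr; lra.
exists V', par', l', U', (Z ++ Z1); split => //.
- split.
  + split; last first.
    * move=> x; rewrite V'P /par' /l' => /andP[_ xV].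
      by case: eqP => [->//|_]; exact: Vl.
    * by rewrite /l' eq_sym (negbTE art).
    split.
    * by rewrite V'P rtDr.
    * by rewrite /par' eq_sym (negbTE art).
    * move=> x; rewrite !V'P => /andP[xDr xV]; rewrite /par'.
      case: eqP => [_|/eqP xa]; first by rewrite bDr.
      rewrite Vpar// andbT; have [->|xrt] := eqVneq x rt; first by rewrite prt.
      apply/negP => /DrP[i ik pxi]; have ik1 : (i < k.+1)%N by exact: ltnW.
      have [_ /(_ x xV xrt pxi) xi] := fresh _ (chV _ ik1) (chU _ ik1).
      case: i ik pxi ik1 xi => [|i] ik _ _ xi; first by rewrite xi eqxx in xa.
      by move/negP: xDr; apply; apply/DrP; exists i => //; exact: ltnW.
    * have nb n : iter n par' b = iter n par b.
        by elim: n => //= n ->; rewrite /par' (negbTE (ndb n)).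
      move=> x; rewrite V'P => /andP[_ /reach[n]].
      elim: n x => [|n IH] x xn; first by exists 0%N.
      have [xa|xa] := eqVneq x a.
        have [m bm] := reach b bV; exists m.+1; rewrite iterSr /par' xa eqxx -/par'.
        by rewrite nb.
      rewrite iterSr in xn; have [m xm] := IH _ xn.
      by exists m.+1; rewrite iterSr {2}/par' (negbTE xa).
  + by rewrite U'P rtU orbT.
  + apply/fintype.subsetP => x; rewrite U'P => /or3P[/eqP->|xU|/and3P[]//].
      by rewrite V'P aDr.
    by rewrite V'P (fintype.subsetP UV)// andbT; apply/negP => /DrU; rewrite xU.
  + move=> x xV'; have := xV'; rewrite {1}V'P => /andP[xDr xV].
    rewrite U'P xV' /= => /norP[xa /norP[xU]]; rewrite xU /= => pxb.
    have [xl xun] := fresh x xV xU; rewrite /par' /l' (negbTE xa); split=> // y.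
    rewrite V'P => /andP[_ yV] yrt; case: eqP => [_ bpx|_]; last exact: xun.
    by rewrite bpx eqxx in pxb.
  + have UU' y : y \in U -> y \in U' by rewrite U'P => ->; rewrite orbT.
    move=> x; case: (cov x) => [[y yV xy]|[[c cZ xc] [y yU xy]]]; last first.
      right; split; last by exists y => //; exact: UU'.
      by exists c => //; rewrite mem_cat cZ.
    have [yDr|yDr] := boolP (y \in Dr); last by left; exists y => //; rewrite V'P yDr.
    right; have /DrP[i ik yE] := yDr; split.
      have [c cZ1 yc] := covZ1 (Ordinal ik) (finset.in_setT _).
      exists c; first by rewrite mem_cat cZ1 orbT.
      by apply: near_trans xy _; rewrite yE.
    exists a; first by rewrite U'P eqxx.
    apply: near_trans xy _; apply: near_sym => //.
    by rewrite yE; apply: near_le (chn 0%N i.+1 ik); exact: chle.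
- move=> x _; rewrite /l'; case: eqP => _; by rewrite le_max lexx ?orbT.
- apply: proper_card; apply/fintype.properP; split.
    apply/fintype.subsetP => x; rewrite !inE !negb_or.
    by move=> /andP[/andP[_ /andP[-> _]] /andP[_ ->]].
  by exists a; rewrite !inE ?aU// eqxx.
split.
- rewrite [in leRHS](big_setID Dr)/= -/V' (finset.setIidPr DrV).
  have aV' : a \in V' by rewrite V'P aDr.
  rewrite [leLHS](big_setD1 a)//= [\sum_(x in V') l x](big_setD1 a)//=.
  rewrite {1}/l' eqxx.
  have -> : \sum_(x in (V' :\ a)%SET) l' x = \sum_(x in (V' :\ a)%SET) l x.
    by apply: eq_bigr => x; rewrite !inE /l' => /andP[/negbTE->].
  have -> : \sum_(x in Dr) l x = \sum_(i < k) l (iter i.+1 par a).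
    rewrite big_imset//= => i j _ _ ij; apply/val_inj/eqP; rewrite eqn_leq.
    apply/andP; split; rewrite leqNgt; apply/negP => ji.
      by have /eqP := chinj j.+1 i.+1 ji (ltn_ord i); apply.
    by have /eqP := chinj i.+1 j.+1 ji (ltn_ord j); apply.
  rewrite /chain_weight big_ord_recl /=.
  by rewrite /bump /=; set A := \sum_(i < k) _; set B := \sum_(x in _) _; lra.
- rewrite (leq_trans (leq_card_setU _ _))// cards1 addnC.
  rewrite (leq_trans (leq_add (leq_card_setU _ _) (leqnn 1)))// -addnA leq_add2l.
  rewrite addn1 ltnS; apply/card_le1_eqP => x y; rewrite !inE.
  move=> /andP[/andP[_ xV] /andP[xU /eqP xb]] /andP[/andP[_ yV] /andP[yU /eqP yb]].
  have [_ un] := fresh _ xV xU; apply: un => //; first exact: notrt.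
  by rewrite xb.
- by rewrite size_cat natrD lerD2l.
Qed.

End Shortcut.

Section ShortcutLoop.
Context {R : realType} {X : finMetricType R}.
Implicit Types (G H : rel X) (V U : {set X}) (par : X -> X) (l : X -> R).
Implicit Types (x y a b u v rt : X) (Z : seq X) (E : seq (X * X)).

Definition scale_edges G H (eps r : R) E : Prop :=
  forall u v, (u, v) \in E -> [/\ r <= mdist u v, mdist u v < 2 * r, H u v &
    ~ near_in G u v ((1 + eps) * mdist u v)].

Definition blocked V par l U (D : R) a y : Prop :=
  exists n, [/\ iter n par a = y, forall j, (j < n)%N -> iter j par a \in V,
    forall j, (j < n)%N -> iter j par a \notin U & chain_weight par l a n <= D].

Lemma blocked_cover G H (sig s D : R) rt V par l U Z y :
  symmetric G -> 0 < s -> 0 <= D ->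
  shortcut_state G H sig s D rt V par l U Z ->
  exists Z' : seq X, (size Z')%:R <= D / s + 1 /\
    forall a, blocked V par l U D a y -> exists2 c, c \in Z' & near_in G a c s.
Proof.
move=> Gsym s0 D0 [[rV lrt Vl] rtU UV fresh _].
have notrt x : x \notin U -> x != rt by apply: contraNneq => ->.
pose P a n := [/\ iter n par a = y, forall j, (j < n)%N -> iter j par a \in V,
    forall j, (j < n)%N -> iter j par a \notin U & chain_weight par l a n <= D].
have /boolp.choice[f fP] a : exists n, blocked V par l U D a y -> P a n.
  have [[n an]|na] := pselect (blocked V par l U D a y).
    by exists n.
  by exists 0%N.
have chn a m : (forall j, (j < m)%N -> iter j par a \in V) ->
    (forall j, (j < m)%N -> iter j par a \notin U) ->
    near_in G a (iter m par a) (chain_weight par l a m).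
  move=> aV aU; apply: (near_chain (F := [pred x | (x \in V) && (x \notin U)])).
    by move=> x /andP[xV xU]; have [] := fresh x xV xU.
  by move=> j jm; apply/andP; split; [exact: aV | exact: aU].
have below n a m b : (forall j, (j < n)%N -> iter j par a \in V) ->
    (forall j, (j < n)%N -> iter j par a \notin U) ->
    (forall j, (j < m + n)%N -> iter j par b \in V) ->
    (forall j, (j < m + n)%N -> iter j par b \notin U) ->
    iter n par a = iter (m + n) par b -> iter m par b = a.
  elim: n => [|n IH] aV aU bV bU; first by rewrite addn0.
  rewrite addnS /= => ab; have mn : (m + n < m + n.+1)%N by rewrite addnS.
  apply: IH => [j jn|j jn|j jn|j jn|].
  - exact: aV (ltnW jn).
  - exact: aU (ltnW jn).
  - by apply: bV; exact: ltn_trans jn mn.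
  - by apply: bU; exact: ltn_trans jn mn.
  have [_ un] := fresh _ (bV _ mn) (bU _ mn).
  by apply: un => //; [exact: aV | apply: notrt; exact: aU].
have near_le_height a b m n : P a n -> P b (m + n)%N ->
    near_in G b a (chain_weight par l b m) /\
    chain_weight par l b (m + n) = chain_weight par l b m + chain_weight par l a n.
  move=> an bmn; have ba : iter m par b = a.
    by case: an bmn => ay aV aU _ [bY bV bU _]; apply: below aV aU bV bU _; rewrite bY.
  split; last by rewrite chain_weightD ba.
  have [_ bV bU _] := bmn.
  by rewrite -{1}ba; apply: chn => j jm; [apply: bV | apply: bU]; apply: ltn_addr.
pose Y := [set a | `[< blocked V par l U D a y >]]%SET.
have YP a : a \in Y -> P a (f a) by rewrite inE => /asboolP /fP.
have [||Z' [szZ' Z'P]] := @cover_height _ _ G X Y id (fun a => chain_weight par l a (f a)) D s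
  Gsym s0 D0.
- by move=> a /YP[_ aV aU ->]; rewrite andbT; apply: near_ge0 (chn _ _ aV aU).
- move=> a b /YP aP /YP bP; have [ab|ba] := leqP (f a) (f b) => hab.
    have := near_le_height a b (f b - f a)%N (f a) aP; rewrite subnK// => /(_ bP)[nr ->].
    by rewrite addrK.
  have := near_le_height b a (f a - f b)%N (f b) bP; rewrite subnK 1?ltnW// => /(_ aP)[nr E].
  apply: near_sym => //; move: hab; rewrite E gerDr => c0; have c1 := near_ge0 nr.
  by apply: near_le nr; lra.
exists Z'; split=> // a aB; apply: Z'P; rewrite inE; exact/asboolP.
Qed.

Lemma shortcut_or_blocked G H (eps r : R) rt V par l U Z u v a b :
  symmetric G -> symmetric H -> subrel G H -> 0 < eps < 1 -> 0 < r ->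
  shortcut_state G H (3 / 32 * eps * r) (eps * r / 32) (5 * r) rt V par l U Z ->
  r <= mdist u v -> mdist u v < 2 * r -> H u v ->
  ~ near_in G u v ((1 + eps) * mdist u v) ->
  a \in V -> near_in G u a (3 / 32 * eps * r) ->
  b \in V -> near_in G v b (3 / 32 * eps * r) ->
  (forall n, iter n par b != a) ->
  (exists2 y, y \in U & blocked V par l U (5 * r) a y) \/
  exists V' par' l' U' Z',
  [/\ shortcut_state G H (3 / 32 * eps * r) (eps * r / 32) (5 * r) rt V' par' l' U' Z',
    V' \subset V, forall x, x \in V' -> l' x <= Num.max (l x) (3 * r),
    (#|V' :\: U'| < #|V :\: U|)%N &
    [/\ \sum_(x in V') l' x <= \sum_(x in V) l x - eps * r / 2,
        (#|U'| <= #|U| + 2)%N &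
        (size Z')%:R <= (size Z)%:R + (160 / eps + 1)]].
Proof.
move=> Gsym Hsym GH /andP[eps0 eps1] r0 st ruv uvr Huv nuv aV ua bV vb ndb.
set sig := 3 / 32 * eps * r in ua vb st *.
set s := eps * r / 32 in st *.
have er0 : 0 < eps * r by rewrite mulr_gt0.
have err : eps * r < r by rewrite gtr_pMl.
have s0 : 0 < s by rewrite divr_gt0.
have [[rV lrt Vl] rtU UV fresh _] := st.
have [_ _ _ reach] := rV.
have chV j : iter j par a \in V := iter_par_in j rV aV.
have exU : exists n, iter n par a \in U.
  by have [n an] := reach a aV; exists n; rewrite an.
case: (ex_minnP exU) => n anU minU.
have chU j : (j < n)%N -> iter j par a \notin U.
  by move=> jn; apply/negP => /minU; rewrite leqNgt jn.
have [chn|chn] := leP (chain_weight par l a n) (5 * r).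
  by left; exists (iter n par a) => //; exists n; split.
right.
have exm : exists m, (5 * r < chain_weight par l a m) || (iter m par a == b).
  by exists n; rewrite chn.
case: (ex_minnP exm) => -[|k] kP mink.
  exfalso; have := ndb 0%N; move: kP; rewrite /chain_weight big_ord0 /= ltNge.
  by rewrite mulr_ge0 ?ltW//= eq_sym => ->.
have kn : (k < n)%N by apply: mink; rewrite chn.
have chb j : (j < k.+1)%N -> iter j par a != b.
  move=> jk; apply/negP => jb; have := mink j; rewrite jb orbT => /(_ isT).
  by rewrite leqNgt jk.
have chk : chain_weight par l a k <= 5 * r.
  rewrite leNgt; apply/negP => ck; have := mink k; rewrite ck => /(_ isT).
  by rewrite ltnn.
have chU' j : (j < k.+1)%N -> iter j par a \notin U.
  by move=> jk; apply: chU; exact: leq_trans kn.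
pose w := mdist u v + sig + sig.
have ab : near_in H a b w.
  have -> : w = sig + mdist u v + sig by rewrite /w; lra.
  apply: near_trans (near_sub GH vb); apply: near_trans (near_edge Huv).
  exact: near_sym Hsym (near_sub GH ua).
have gain : eps * r / 2 <= chain_weight par l a k.+1 - w.
  case/orP: kP => [big|/eqP kb]; first by rewrite /w /sig; lra.
  have [ch|ch] := leP (eps * r / 2) (chain_weight par l a k.+1 - w) => //.
  exfalso; apply: nuv; have : near_in G a b (chain_weight par l a k.+1).
    rewrite -kb; apply: (near_chain (F := [pred x | (x \in V) && (x \notin U)])).
      by move=> x /andP[xV xU]; have [] := fresh x xV xU.
    by move=> j jk; apply/andP; split=> //; exact: chU'.
  move=> ab'; apply: near_le (near_trans (near_trans ua ab') (near_sym Gsym vb)).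
  have : eps * r <= eps * mdist u v by rewrite ler_pM2l.
  by move: ch; rewrite /w /sig; lra.
have D0 : 0 <= 5 * r by rewrite mulr_ge0// ltW.
have [V' [par' [l' [U' [Z' [st' V'V l'l VU [suml cU szZ]]]]]]] :=
  shortcut Gsym s0 D0 st bV (fun j _ => chV j) chU' chb ndb ab chk.
exists V', par', l', U', Z'; split=> //.
- move=> x /l'l /le_trans; apply; rewrite ge_max !le_max lexx /=.
  by apply/orP; right; rewrite /w /sig; lra.
- split=> //; first by apply: le_trans suml _; lra.
  apply: le_trans szZ _; rewrite lerD2l lerD2r /s.
  have -> : 5 * r / (eps * r / 32) = 160 / eps.
    have e0 : eps != 0 by rewrite gt_eqF.
    have e1 : eps * r / 32 != 0 by rewrite gt_eqF.
    apply/eqP; rewrite eqr_div//.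
    by apply/eqP; lra.
  by [].
Qed.

End ShortcutLoop.

Section ScaleStep.
Context {R : realType} {X : finMetricType R}.
Implicit Types (G H : rel X) (V U : {set X}) (par : X -> X) (l : X -> R).
Implicit Types (x y a b u v rt : X) (Z : seq X) (E : seq (X * X)).

Lemma shortcut_loop G H (eps r : R) E rt V par l U Z :
  symmetric G -> symmetric H -> subrel G H -> 0 < eps < 1 -> 0 < r ->
  scale_edges G H eps r E ->
  shortcut_state G H (3 / 32 * eps * r) (eps * r / 32) (5 * r) rt V par l U Z ->
  exists V' par' l' U' Z',
  [/\ shortcut_state G H (3 / 32 * eps * r) (eps * r / 32) (5 * r) rt V' par' l' U' Z',
    V' \subset V, forall x, x \in V' -> l' x <= Num.max (l x) (3 * r),
    (size Z')%:R + (160 / eps + 1) * #|U'|%:R + 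
      (\sum_(x in V') l' x) * (6 * (160 / eps + 1) / (eps * r)) <=
    (size Z)%:R + (160 / eps + 1) * #|U|%:R + 
      (\sum_(x in V) l x) * (6 * (160 / eps + 1) / (eps * r)) &
    \sum_(x in V') l' x <= \sum_(x in V) l x /\
    forall u v, (u, v) \in E -> exists2 x, x = u \/ x = v &
      (exists2 c, c \in Z' & near_in G x c (3 / 32 * eps * r + eps * r / 32)) \/
      (exists2 a, near_in G x a (3 / 32 * eps * r) &
        exists2 y, y \in U' & blocked V' par' l' U' (5 * r) a y)].
Proof.
move=> Gsym Hsym GH eps01 r0 Ee; have [n] := ubnP #|V :\: U|%SET.
have /andP[eps0 eps1] := eps01; have er0 : 0 < eps * r by rewrite mulr_gt0.
set q := 160 / eps + 1; have q0 : 0 < q by rewrite addr_gt0// divr_gt0.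
have kr0 : 0 < 6 * q / (eps * r) by rewrite divr_gt0// mulr_gt0.
elim: n V par l U Z => // n IH V par l U Z VUn st.
have [[u [v [a [b [uvE aV ua bV [vb short]]]]]]|done_] := pselect (exists u v a b,
    [/\ (u, v) \in E \/ (v, u) \in E, a \in V, near_in G u a (3 / 32 * eps * r), b \in V &
    near_in G v b (3 / 32 * eps * r) /\ (forall n, iter n par b != a) /\
    ~ (exists2 y, y \in U & blocked V par l U (5 * r) a y)]).
  have [ruv uvr Huv nuv] : [/\ r <= mdist u v, mdist u v < 2 * r, H u v &
      ~ near_in G u v ((1 + eps) * mdist u v)].
    case: uvE => /Ee[ruv uvr Huv nuv]; first by split.
    rewrite metric_sym Hsym; split=> // uv; apply: nuv; exact: near_sym.
  have [ndb nbl] := short.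
  have [//|[V1 [par1 [l1 [U1 [Z1 [st1 V1V l1l VU1 [sum1 cU1 sz1]]]]]]]] :=
    shortcut_or_blocked Gsym Hsym GH eps01 r0 st ruv uvr Huv nuv aV ua bV vb ndb.
  have [||V' [par' [l' [U' [Z' [st' V'V1 l'l1 pot [sum' caught]]]]]]] :=
    IH V1 par1 l1 U1 Z1 => //.
    by apply: leq_trans VU1 _; rewrite -ltnS.
  exists V', par', l', U', Z'; split=> //.
  - exact: fintype.subset_trans V1V.
  - move=> x xV'; apply: (le_trans (l'l1 _ xV')).
    have := l1l _ (fintype.subsetP V'V1 _ xV'); rewrite !ge_max le_max => -> /=.
    by rewrite le_max lexx orbT.
  - apply: (le_trans pot).
    have cU : #|U1|%:R <= #|U|%:R + 2 :> R by rewrite -natrD ler_nat.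
    have qU : q * #|U1|%:R <= q * (#|U|%:R + 2) by rewrite ler_pM2l.
    have sumk : (\sum_(x in V1) l1 x) * (6 * q / (eps * r)) <=
        (\sum_(x in V) l x - eps * r / 2) * (6 * q / (eps * r)) by rewrite ler_pM2r.
    have ek : eps * r / 2 * (6 * q / (eps * r)) = 3 * q.
      transitivity (3 * q * (eps * r / (eps * r))); first by lra.
      by rewrite divff ?mulr1// gt_eqF.
    move: sz1; rewrite -/q => sz1; move: sumk; rewrite mulrBl ek.
    set P := (\sum_(x in V1) l1 x) * _; set Q := (\sum_(x in V) l x) * _.
    by lra.
  - by split=> //; apply: le_trans sum' (le_trans sum1 _); lra.
exists V, par, l, U, Z; split=> //; first by move=> x _; rewrite le_max lexx.
split=> // u v uvE.
have [[a aV ua]|[uZ _]] := st_cover st u; last by exists u; [left|left].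
have [[b bV vb]|[vZ _]] := st_cover st v; last by exists v; [right|left].
have [ruv uvr Huv nuv] := Ee u v uvE.
have [rV _ _] := st_tree st.
have ab : a != b.
  apply/eqP => ab; apply: nuv; rewrite -ab in vb.
  apply: near_le (near_trans ua (near_sym Gsym vb)).
  have : 0 <= eps * mdist u v by rewrite mulr_ge0 ?mdist_ge0// ltW.
  have : eps * r < r by rewrite gtr_pMl.
  by lra.
have [nd|nd] := pselect (forall n, iter n par b != a).
  have [[y yU ay]|nbl] := pselect (exists2 y, y \in U & blocked V par l U (5 * r) a y).
    by exists u; [left|right; exists a => //; exists y].
  by case: done_; exists u, v, a, b; split=> //; left.
have nd' n' : iter n' par a != b.
  apply/eqP => nab; apply: nd => m; apply/eqP => mba.
  by move/eqP: ab; apply; exact: (descendants_antisym rV aV bV nab mba).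
have [[y yU ay]|nbl] := pselect (exists2 y, y \in U & blocked V par l U (5 * r) b y).
  by exists v; [right|right; exists b => //; exists y].
by case: done_; exists v, u, b, a; split=> //; right.
Qed.

Lemma size_flatten_map (I : eqType) (f : I -> seq X) (s : seq I) (q : R) :
  (forall i, i \in s -> (size (f i))%:R <= q) ->
  (size (flatten (map f s)))%:R <= q * (size s)%:R.
Proof.
elim: s => [|i s IH] fq; first by rewrite mulr0.
rewrite /= size_cat natrD -natr1 mulrDr mulr1 addrC lerD//.
  by apply: IH => j js; apply: fq; rewrite inE js orbT.
by apply: fq; rewrite inE eqxx.
Qed.

Lemma scale_step G H (eps r : R) E rt V par l :
  symmetric G -> symmetric H -> subrel G H -> 0 < eps < 1 -> 0 < r ->
  scale_edges G H eps r E -> tree_in G rt V par l ->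
  (forall x, exists2 y, y \in V & near_in G x y (eps * r / 32)) ->
  exists V' par' l' Z, [/\ tree_in H rt V' par' l',
    forall x, exists2 y, y \in V' & near_in G x y (6 * r),
    V' \subset V, forall x, x \in V' -> l' x <= Num.max (l x) (3 * r) &
    (forall u v, (u, v) \in E -> exists2 x, x = u \/ x = v &
       exists2 c, c \in Z & near_in G x c (eps * r / 8)) /\
    (size Z)%:R <= (160 / eps + 1) *
      (3 + 2 * #|[set x in V | eps * r / 32 <= l x]%SET|%:R +
       64 * (\sum_(x in V) l x - \sum_(x in V') l' x) / (eps * r))].
Proof.
move=> Gsym Hsym GH eps01 r0 Ee [rV lrt Vl] cov.
have /andP[eps0 eps1] := eps01; have er0 : 0 < eps * r by rewrite mulr_gt0.
have err : eps * r < r by rewrite gtr_pMl.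
set s := eps * r / 32 in cov *; have s0 : 0 < s by rewrite divr_gt0.
have q0 : 0 < 160 / eps + 1 by rewrite addr_gt0// divr_gt0.
have s20 : 0 <= 2 * s by rewrite mulr_ge0// ltW.
have [V1 [g [V1V rV1 g0 sumg [leaf cov1]]]] := prune_leaves rV Vl Gsym s20.
pose U := (rt |: [set y in V1 | (y != rt) && (1 < #|children rt V1 par (par y)|)%N])%SET.
have [rtV1 _ _ _] := rV1.
have st : shortcut_state G H (3 / 32 * eps * r) s (5 * r) rt V1 par l U [::].
  split.
  - split=> // x xV1; apply: near_sub GH _; apply: Vl; exact: (fintype.subsetP V1V).
  - by rewrite !inE eqxx.
  - by apply/fintype.subsetP => x; rewrite !inE => /orP[/eqP->|/andP[]].
  - move=> x xV1; rewrite !inE xV1 /= negb_or negb_and negbK => /andP[xrt].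
    rewrite (negbTE xrt) /= -leqNgt => c1; split.
      exact: Vl _ (fintype.subsetP V1V _ xV1).
    move=> y yV1 yrt pyx; move/card_le1_eqP: c1; apply; rewrite !inE.
      by rewrite xV1 xrt eqxx.
    by rewrite yV1 yrt pyx eqxx.
  - move=> x; left; have [y yV xy] := cov x; have [y' y'V1 yy'] := cov1 y yV.
    exists y' => //; apply: near_le (near_trans xy yy'); rewrite /s; lra.
have [V' [par' [l' [U' [Z' [st' V'V1 l'l pot [sum' caught]]]]]]] :=
  shortcut_loop Gsym Hsym GH eps01 r0 Ee st.
have D0 : 0 <= 5 * r by rewrite mulr_ge0// ltW.
have q'E : 5 * r / s = 160 / eps.
  have e0 : eps != 0 by rewrite gt_eqF.
  have e1 : eps * r / 32 != 0 by rewrite gt_eqF.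
  by apply/eqP; rewrite /s eqr_div//; apply/eqP; lra.
have /boolp.choice[f fP] : forall y, exists Zy : seq X, (size Zy)%:R <= 160 / eps + 1 /\
    forall a, blocked V' par' l' U' (5 * r) a y -> exists2 c, c \in Zy & near_in G a c s.
  by move=> y; rewrite -q'E; exact: (blocked_cover y Gsym s0 D0 st').
exists V', par', l', (Z' ++ flatten (map f (enum U'))); split=> //.
- exact: st_tree st'.
- move=> x; have U'V' := fintype.subsetP (st_sub st').
  have [[y yV' xy]|[_ [y yU' xy]]] := st_cover st' x.
    by exists y => //; apply: near_le xy; lra.
  by exists y; [exact: U'V'|apply: near_le xy; lra].
- exact: fintype.subset_trans V1V.
split.
  move=> u v /caught [x xuv xc]; exists x => //.
  case: xc => [[c cZ' xc]|[a xa [y yU' ay]]].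
    by exists c; rewrite ?mem_cat ?cZ'//; apply: near_le xc; lra.
  have [c cy ac] := (fP y).2 a ay; exists c.
    rewrite mem_cat; apply/orP; right; apply/flattenP; exists (f y) => //.
    by apply: map_f; rewrite mem_enum.
  by apply: near_le (near_trans xa ac); rewrite /s; lra.
set q := 160 / eps + 1 in q0 pot fP *.
rewrite size_cat natrD.
have szf : (size (flatten (map f (enum U'))))%:R <= q * #|U'|%:R.
  by rewrite cardE; apply: size_flatten_map => y _; exact: (fP y).1.
pose L := [set x in V1 | #|children rt V1 par x| == 0%N]%SET.
have cU : (#|U| <= 1 + 2 * #|L|)%N.
  rewrite (leq_trans (leq_card_setU _ _))// cards1 leq_add2l.
  exact: card_branching_children.
pose A := [set x in V | s <= l x]%SET.
pose B := [set x in V1 | s <= g x]%SET.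
have cL : (#|L| <= 1 + (#|A| + #|B|))%N.
  apply: leq_trans (_ : #|rt |: (A :|: B)|%SET <= _)%N.
    apply: subset_leq_card; apply/fintype.subsetP => x; rewrite !inE.
    move=> /andP[xV1 /eqP xl]; rewrite xV1 (fintype.subsetP V1V _ xV1) /=.
    have [//|xrt] := eqVneq x rt; have := leaf x xV1 xrt xl.
    have [//|lxs] := leP s (l x); have [//|gxs] := leP s (g x).
    by lra.
  rewrite (leq_trans (leq_card_setU _ _))// cards1 leq_add2l.
  exact: leq_card_setU.
have cB : s * #|B|%:R <= \sum_(x in V1) g x.
  rewrite mulr_natr -sumr_const [leRHS](big_setID B)/=.
  rewrite (finset.setIidPr _); last first.
    by apply/fintype.subsetP => x; rewrite inE => /andP[].
  rewrite -[leLHS]addr0 lerD//.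
    by apply: ler_sum => x; rewrite inE => /andP[].
  by apply: sumr_ge0 => x; rewrite inE => /andP[_ /g0].
have cUR : #|U|%:R <= 3 + 2 * #|A|%:R + 2 * #|B|%:R :> R.
  have : (#|U| <= 3 + 2 * #|A| + 2 * #|B|)%N.
    by move: cU cL; move: #|U| #|L| #|A| #|B| => ? ? ? ?; clear; lia.
  by rewrite -(ler_nat R) natrD natrD natrM natrM.
have i0 : 0 < (eps * r)^-1 by rewrite invr_gt0.
have cBi : #|B|%:R <= 32 * (\sum_(x in V1) g x) * (eps * r)^-1.
  by rewrite ler_pdivlMr//; move: cB; rewrite /s; lra.
apply: (le_trans (lerD (lexx _) szf)); move: pot sum' sumg cUR cBi.
rewrite /= add0r mulrA [6 * q * _]mulrC -/A.
set k := (eps * r)^-1 in i0 *; set S0 := \sum_(x in V) l x.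
set S1 := \sum_(x in V1) l x; set S' := \sum_(x in V') l' x.
set G1 := \sum_(x in V1) g x => pot sum' sumg cUR cBi.
have GS : (G1 + (S1 - S')) * k <= (S0 - S') * k by rewrite ler_pM2r//; lra.
have S1k : 0 <= (S1 - S') * k by rewrite mulr_ge0 ?subr_ge0// ltW.
have : q * (#|U|%:R + 6 * ((S1 - S') * k)) <=
    q * (3 + 2 * #|A|%:R + 64 * (S0 - S') * k) by rewrite ler_pM2l//; lra.
by move: pot; lra.
Qed.

End ScaleStep.

Lemma size_le_cover (R : realType) (I J : eqType) (P : I -> pred J)
    (Z : seq I) (E : seq J) (q : R) :
  (forall e, e \in E -> exists2 c, c \in Z & P c e) ->
  (forall c, (size [seq e <- E | P c e])%:R <= q) ->
  (size E)%:R <= q * (size Z)%:R.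
Proof.
elim: Z E => [|c Z IH] E EZ Eq.
  case: E EZ Eq => [|e E] EZ _; first by rewrite mulr0.
  by have [] := EZ e; rewrite ?inE ?eqxx.
rewrite -(count_predC (P c) E) -!size_filter natrD /= -natr1 mulrDr mulr1 addrC.
apply: lerD => //; apply: IH => [e|c'].
  rewrite mem_filter => /andP[/= nce /EZ[c']].
  by rewrite inE => /orP[/eqP->|]; [rewrite (negbTE nce)|exists c'].
apply: le_trans (Eq c'); rewrite ler_nat !size_filter count_filter.
by apply: sub_count => e /andP[].
Qed.

Section Packing.
Context {R : realType} {X : finMetricType R}.
Implicit Types (x y c : X).

Lemma ball_cover_iter (d : R) (k : nat) x (r : R) : half_ball_cover X d -> 0 < r ->
  exists A : {set X}, #|A|%:R <= (2 `^ d) ^+ k /\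
    ball x r `<=` \bigcup_(c in [set` A]) ball c (r / 2 ^+ k).
Proof.
move=> hd r0; elim: k => [|k [A [cA covA]]].
  exists [set x]%SET; rewrite cards1 expr0; split=> // y xy.
  by exists x; rewrite ?divr1//= inE.
have rk0 : 0 < r / 2 ^+ k by rewrite divr_gt0// exprn_gt0.
have /boolp.choice[f fP] := fun c => hd c _ rk0.
exists (\bigcup_(c in A) f c)%SET; split.
  apply: (@le_trans _ _ (\sum_(c in A) 2 `^ d)).
    apply: (@le_trans _ _ (\sum_(c in A) #|f c|)%:R).
      rewrite ler_nat; elim/big_rec2: _ => [|c n B _ cB]; first by rewrite cards0.
      by rewrite (leq_trans (leq_card_setU _ _))// leq_add2l.
    by rewrite natr_sum; apply: ler_sum => c _; case: (fP c).
  by rewrite sumr_const -[leLHS]mulr_natl exprSr ler_wpM2r// powR_ge0.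
move=> y /covA[c /= cA' cy]; have [_ /(_ y cy)[c' /= c'f c'y]] := fP c.
exists c'; first by apply/bigcupP; exists c.
by rewrite exprSr invfM mulrA.
Qed.

Lemma separated_card (d : R) (k : nat) x (r b : R) (P : {set X}) :
  half_ball_cover X d -> 0 < r -> r / 2 ^+ k <= b / 2 ->
  (forall y, y \in P -> mdist x y < r) ->
  (forall y z, y \in P -> z \in P -> y != z -> b <= mdist y z) ->
  #|P|%:R <= (2 `^ d) ^+ k.
Proof.
move=> hd r0 rb Px Psep; have [A [cA covA]] := ball_cover_iter k x hd r0.
apply: le_trans cA; rewrite ler_nat.
have /boolp.choice[f fP] y : exists c, y \in P -> c \in A /\ mdist c y < r / 2 ^+ k.
  have [yP|yP] := boolP (y \in P); last by exists x.
  have : ball x r y by rewrite ballEmdist /=; exact: Px.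
  by move=> /covA[c /= cA']; rewrite ballEmdist => cy; exists c.
have finj : {in P &, injective f}.
  move=> y z yP zP fyz; apply/eqP; apply: contraT => yz.
  have [_ fy] := fP y yP; have [_ fz] := fP z zP; have := Psep y z yP zP yz.
  have := metric_triangle y (f y) z; rewrite metric_sym fyz in fy *.
  by rewrite [mdist y _]metric_sym; lra.
rewrite -(card_in_imset finj); apply: subset_leq_card.
by apply/fintype.subsetP => _ /imsetP[y yP ->]; case: (fP y yP).
Qed.

End Packing.

Section Greedy.
Context {R : realType} {X : finMetricType R}.
Implicit Types (T : rel X) (A : seq (X * X)) (e f : X * X) (t r : R).

Definition edge_len e : R := mdist e.1 e.2.

Definition add_edges T A : rel X :=
  [rel x y | [|| T x y, (x, y) \in A | (y, x) \in A]].

Definition edges_lt r A : seq (X * X) := [seq e <- A | edge_len e < r].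

Definition greedy_edges T t A : Prop := forall A1 e A2, A = A1 ++ e :: A2 ->
  ~ near_in (add_edges T A1) e.1 e.2 (t * edge_len e).

Lemma add_edges_sym T A : symmetric T -> symmetric (add_edges T A).
Proof. by move=> Tsym x y; rewrite /add_edges /= Tsym [((x, y) \in A) || _]orbC. Qed.

Lemma add_edges_sub T A B :
  {subset A <= B} -> subrel (add_edges T A) (add_edges T B).
Proof.
by move=> AB x y /or3P[xy|/AB xy|/AB xy]; apply/or3P;
  [constructor 1|constructor 2|constructor 3].
Qed.

Lemma greedy_exists T t (L : seq (X * X)) : 1 <= t ->
  exists A, [/\ subseq A L, greedy_edges T t A &
    forall e, e \in L -> near_in (add_edges T A) e.1 e.2 (t * edge_len e)].
Proof.
move=> t1; elim/last_ind: L => [|L e [A [AL gA cov]]].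
  by exists [::]; split=> // -[|? ?].
have [ne|ne] := pselect (near_in (add_edges T A) e.1 e.2 (t * edge_len e)).
  exists A; split=> //; first exact: subseq_trans (subseq_rcons _ _).
  by move=> f; rewrite mem_rcons inE => /orP[/eqP->|/cov].
exists (rcons A e); split.
- by rewrite -!cats1 cat_subseq.
- move=> A1 f A2; case/lastP: A2 => [|A2 g].
    by rewrite cats1 => /rcons_inj[<- <-].
  by rewrite -rcons_cons -rcons_cat => /rcons_inj[AE _]; exact: gA AE.
- move=> f; rewrite mem_rcons inE => /orP[/eqP->|/cov]; last first.
    apply: near_sub; apply: add_edges_sub => g gA'.
    by rewrite mem_rcons inE gA' orbT.
  apply: (@near_le _ _ _ _ _ (edge_len e)).
    by rewrite ler_peMl// mdist_ge0.
  by apply: near_edge; rewrite /add_edges /= mem_rcons inE -surjective_pairing eqxx orbT.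
Qed.

Definition len_le : rel (X * X) := [rel e f | edge_len e <= edge_len f].

Lemma len_sorted_cat A1 e A2 : sorted len_le (A1 ++ e :: A2) ->
  (forall f, f \in A1 -> edge_len f <= edge_len e) /\
  (forall f, f \in A2 -> edge_len e <= edge_len f).
Proof.
have tr : transitive len_le by move=> ? ? ? /=; exact: le_trans.
rewrite (sorted_pairwise tr) pairwise_cat pairwise_cons.
case/and4P => /allrelP ae _ /allP ea _; split=> f fA; last exact: ea.
by apply: ae => //; rewrite inE eqxx.
Qed.

Lemma greedy_far T t A r e : sorted len_le A -> greedy_edges T t A ->
  e \in A -> r <= edge_len e ->
  ~ near_in (add_edges T (edges_lt r A)) e.1 e.2 (t * edge_len e).
Proof.
move=> sA gA eA; case/splitPr: eA sA gA => A1 A2 sA gA re near_e.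
apply: (gA A1 e A2 erefl); apply: near_sub near_e; apply: add_edges_sub => f.
rewrite mem_filter mem_cat inE => /andP[fr /or3P[//|/eqP fe|fA2]].
  by move: fr; rewrite fe ltNge re.
have [_ /(_ f fA2) ef] := len_sorted_cat sA.
by move: fr; rewrite ltNge (le_trans re).
Qed.

Definition blocks T t A e f : Prop := edge_len e <= edge_len f /\
  forall r, r <= edge_len f ->
  ~ near_in (add_edges T (e :: edges_lt r A)) f.1 f.2 (t * edge_len f).

Lemma greedy_pair T t A e f : sorted len_le A -> greedy_edges T t A ->
  e \in A -> f \in A -> e != f -> blocks T t A e f \/ blocks T t A f e.
Proof.
have main A1 A2 e' f' : sorted len_le (A1 ++ f' :: A2) ->
    greedy_edges T t (A1 ++ f' :: A2) -> e' \in A1 -> blocks T t (A1 ++ f' :: A2) e' f'.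
  move=> sA gA eA1; have [Af fA] := len_sorted_cat sA.
  split=> [|r rf nf]; first exact: Af.
  apply: (gA A1 f' A2 erefl); apply: near_sub nf; apply: add_edges_sub => g.
  rewrite inE => /orP[/eqP->//|].
  rewrite mem_filter mem_cat inE => /andP[gr /or3P[//|/eqP ge|gA2]].
    by move: gr; rewrite ge ltNge rf.
  by move: gr; rewrite ltNge (le_trans rf)// fA.
move=> sA gA eA; case/splitPr: eA sA gA => A1 A2 sA gA.
rewrite mem_cat inE => /or3P[fA1|/eqP->|fA2]; last 2 first.
- by rewrite eqxx.
- move=> _; left; case/splitPr: fA2 sA gA => B1 B2.
  rewrite -cat_cons catA => sA gA; apply: main => //.
  by rewrite mem_cat inE eqxx orbT.
- by move=> _; right; exact: main.
Qed.

Definition src (b : bool) e : X := if b then e.1 else e.2.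
Definition dst (b : bool) e : X := if b then e.2 else e.1.

Lemma near_src_dst G b e t : symmetric G ->
  near_in G (src b e) (dst b e) t -> near_in G e.1 e.2 t.
Proof. by case: b => //= Gsym; exact: near_sym. Qed.

Lemma mdist_src_dst b e : mdist (src b e) (dst b e) = edge_len e.
Proof. by case: b => //=; rewrite metric_sym. Qed.

(* Two edges of nearly the same length that start near a common point [c] have
   separated other ends: otherwise the shorter one could serve as a detour for
   the longer one. *)
Lemma greedy_degree (d : R) (k : nat) T (eps r : R) A F b c :
  half_ball_cover X d -> symmetric T -> 0 < eps < 1 -> 0 < r -> 48 / eps <= 2 ^+ k ->
  sorted len_le A -> greedy_edges T (1 + eps) A ->
  (forall x y, near_in (add_edges T A) x y ((1 + eps) * mdist x y)) ->
  uniq F ->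
  (forall e, e \in F -> [/\ e \in A, r <= edge_len e < 2 * r &
     near_in (add_edges T (edges_lt r A)) (src b e) c (eps * r / 8)]) ->
  (size F)%:R <= (2 `^ d) ^+ k.
Proof.
move=> hd Tsym /andP[eps0 eps1] r0 hk sA gA span uF FP.
have er0 : 0 < eps * r by rewrite mulr_gt0.
have err : eps * r < r by rewrite gtr_pMl.
have Gsym B : symmetric (add_edges T B) by exact: add_edges_sym.
have short x y : mdist x y < eps * r / 8 ->
    near_in (add_edges T (edges_lt r A)) x y (2 * (eps * r / 8)).
  move=> xy; have m0 := mdist_ge0 x y.
  have le2 : (1 + eps) * mdist x y <= 2 * (eps * r / 8).
    have : eps * mdist x y <= mdist x y by rewrite ler_piMl// ltW.
    by lra.
  apply: near_le (le2) _; have := near_light (span x y); apply: near_sub.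
  move=> a a' /= /andP[aa' la]; have lr : mdist a a' < r.
    by apply: le_lt_trans la (le_lt_trans le2 _); lra.
  case/or3P: aa' => [aa'|aA|aA]; rewrite /add_edges /= ?aa'// /edges_lt !mem_filter.
    by rewrite /edge_len /= lr aA orbT.
  by rewrite /edge_len /= [mdist a' a]metric_sym lr aA !orbT.
have noblock e f : e \in F -> f \in F -> mdist (dst b e) (dst b f) < eps * r / 8 ->
    ~ blocks T (1 + eps) A e f.
  move=> eF fF def [lef nf]; have [eA /andP[re er] ec] := FP e eF.
  have [fA /andP[rf fr] fc] := FP f fF; apply: (nf r rf).
  apply: (near_src_dst (b := b)) => //.
  have sub : subrel (add_edges T (edges_lt r A)) (add_edges T (e :: edges_lt r A)).
    by apply: add_edges_sub => g gA'; rewrite inE gA' orbT.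
  have ee : near_in (add_edges T (e :: edges_lt r A)) (src b e) (dst b e) (edge_len e).
    rewrite -(mdist_src_dst b); apply: near_edge.
    rewrite /add_edges; case: b {ec fc def FP} => /=;
      by rewrite !inE -surjective_pairing eqxx ?orbT.
  have h1 := near_trans (near_sub sub fc) (near_sym (Gsym _) (near_sub sub ec)).
  have h2 := near_trans (near_trans h1 ee) (near_sub sub (short _ _ def)).
  apply: near_le h2.
  have : eps * r <= eps * edge_len f by rewrite ler_pM2l.
  by lra.
have sep e f : e \in F -> f \in F -> e != f -> eps * r / 8 <= mdist (dst b e) (dst b f).
  move=> eF fF ef; rewrite leNgt; apply/negP => def.
  have [[eA _ _] [fA _ _]] := (FP e eF, FP f fF).
  have [] := greedy_pair sA gA eA fA ef; first exact: noblock.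
  by apply: noblock => //; rewrite metric_sym.
have uM : uniq (map (dst b) F).
  rewrite map_inj_in_uniq// => e f eF fF ef; apply/eqP; apply: contraT => nef.
  by have := sep e f eF fF nef; rewrite ef mdistxx leNgt divr_gt0.
have -> : size F = #|[set v in map (dst b) F]%SET|.
  by rewrite cardsE (card_uniqP uM) size_map.
have r30 : 0 < 3 * r by rewrite mulr_gt0.
apply: (separated_card (x := c) (b := eps * r / 8) hd r30).
- have k0 : 0 < 2 ^+ k :> R by rewrite exprn_gt0.
  rewrite ler_pdivrMr//; move: hk; rewrite ler_pdivrMr// => hk.
  have : 48 * r <= 2 ^+ k * eps * r by rewrite ler_pM2r.
  by lra.
- move=> y; rewrite inE => /mapP[e eF ->]; have [eA /andP[re er] ec] := FP e eF.
  have := metric_triangle c (src b e) (dst b e); rewrite mdist_src_dst.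
  rewrite [mdist c (src _ _)]metric_sym.
  by have := mdist_near ec; lra.
- move=> y z; rewrite !inE => /mapP[e eF ->] /mapP[f fF ->] ef.
  by apply: sep => //; apply: contraNneq ef => ->.
Qed.

End Greedy.

Section ClassSum.
Context {R : realType} {X : finMetricType R}.
Implicit Types (T : rel X) (A : seq (X * X)) (V : {set X}) (rt x y : X).
Implicit Types (par : X -> X) (l : X -> R).

Lemma connected_parent T rt : connected_graph T ->
  exists par (h : X -> nat), [/\ rooted rt [set: X]%SET par,
    forall x, x != rt -> T x (par x) & forall x, x != rt -> (h (par x) < h x)%N].
Proof.
move=> conn.
pose P x n := [exists p : n.-tuple X, path T x p && (last x p == rt)].
have exP x : exists n, P x n.
  have /connectP[p xp rtp] := conn x rt; exists (size p).
  by apply/existsP; exists (in_tuple p); rewrite /= xp -rtp eqxx.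
pose h x := ex_minn (exP x).
have h_path x : exists p, [/\ path T x p, last x p = rt & size p = h x].
  rewrite /h; case: ex_minnP => n /existsP[[p /= /eqP pn] /andP[xp /eqP lp]] _.
  by exists p.
have h_min x p : path T x p -> last x p = rt -> (h x <= size p)%N.
  move=> xp lp; rewrite /h; case: ex_minnP => n _; apply; apply/existsP.
  by exists (in_tuple p); rewrite /= xp lp eqxx.
have /boolp.choice[par parP] x : exists y, (x = rt -> y = rt) /\
    (x != rt -> T x y /\ (h y < h x)%N).
  have [->|xrt] := eqVneq x rt; first by exists rt.
  have [[|y p] [/= xp lp <-]] := h_path x; first by rewrite lp eqxx in xrt.
  case/andP: xp => xy yp; exists y.
  split=> [xE|_]; first by rewrite xE eqxx in xrt.
  by split=> //; rewrite ltnS; exact: h_min.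
exists par, h; split=> [|x /(parP x).2[]//|x /(parP x).2[]//].
split=> //; first exact: (parP rt).1.
move=> x _; have [n] := ubnP (h x); elim: n x => // n IH x hx.
have [->|xrt] := eqVneq x rt; first by exists 0%N.
have [_ hp] := (parP x).2 xrt; have [|m xm] := IH (par x).
  by apply: leq_trans hp _; rewrite -ltnS.
by exists m.+1; rewrite iterSr.
Qed.

Lemma initial_tree T rt : simple_graph T -> connected_graph T ->
  exists par l, tree_in T rt [set: X]%SET par l /\
    \sum_(x : X) l x <= graph_weight T.
Proof.
move=> [Tsym Tirr] conn; have [par [h [rV Tpar hpar]]] := connected_parent rt conn.
have [_ prt _ _] := rV.
exists par, (fun x => mdist x (par x)); split.
  split=> //; first by rewrite prt mdistxx.
  move=> x _; have [->|xrt] := eqVneq x rt; first by rewrite prt mdistxx; exact: near_refl.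
  exact: near_edge (Tpar x xrt).
rewrite /graph_weight mulrC ler_pdivlMr//.
pose I x y := (x != rt) && (par x == y).
have sumI : \sum_x \sum_(y | I x y) mdist x y = \sum_x mdist x (par x).
  apply: eq_bigr => x _; have [->|xrt] := eqVneq x rt.
    by rewrite big_pred0 ?prt ?mdistxx// => y; rewrite /I eqxx.
  by rewrite (big_pred1 (par x))// => y; rewrite /I xrt /= eq_sym.
have sumI' : \sum_x \sum_(y | I y x) mdist x y = \sum_x mdist x (par x).
  rewrite -sumI (exchange_big_dep xpredT)//=; apply: eq_bigr => x _.
  by apply: eq_bigr => y _; rewrite metric_sym.
have -> : (\sum_x mdist x (par x)) * 2 =
    \sum_x (\sum_(y | I x y) mdist x y + \sum_(y | I y x) mdist x y).
  by rewrite big_split /= sumI sumI'; lra.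
apply: ler_sum => x _; rewrite big_mkcond [X in _ + X]big_mkcond -big_split /=.
rewrite [leRHS]big_mkcond /=; apply: ler_sum => y _.
have IT a b : I a b -> T a b by move=> /andP[art /eqP<-]; exact: Tpar.
have [xy|nxy] := boolP (I x y); have [yx|nyx] := boolP (I y x).
- have /andP[xrt /eqP pxy] := xy; have /andP[yrt /eqP pyx] := yx.
  by have := hpar x xrt; have := hpar y yrt; rewrite pxy pyx ltnNge => /negP hn /ltnW.
- by rewrite (IT _ _ xy) addr0.
- by rewrite Tsym (IT _ _ yx) add0r.
- by rewrite addr0; case: ifP => // _; exact: mdist_ge0.
Qed.

Lemma geometric_sum_le (r0 th b : R) (n : nat) : 0 < r0 -> 2 <= th -> 0 <= b ->
  \sum_(i < n) (if r0 * th ^+ i <= b then r0 * th ^+ i else 0) <= 2 * b.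
Proof.
move=> r00 th2 b0; have th0 : 0 < th by apply: lt_le_trans th2.
have pos i : 0 < r0 * th ^+ i by rewrite mulr_gt0// exprn_gt0.
have all_le m : \sum_(i < m) (r0 * th ^+ i) <= r0 * th ^+ m.
  elim: m => [|m IH]; first by rewrite big_ord0 ltW.
  rewrite big_ord_recr /= exprSr mulrA.
  have : r0 * th ^+ m * 2 <= r0 * th ^+ m * th by rewrite ler_pM2l.
  by lra.
elim: n => [|n IH]; first by rewrite big_ord0 mulr_ge0.
rewrite big_ord_recr /=; case: ifPn => [rb|_]; last by rewrite addr0.
apply: (@le_trans _ _ (\sum_(i < n) (r0 * th ^+ i) + r0 * th ^+ n)).
  rewrite lerD2r; apply: ler_sum => i _; case: ifP => // _; exact: ltW.
by have := all_le n; lra.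
Qed.

Definition edges_at (r : R) A : seq (X * X) :=
  [seq e <- A | r <= edge_len e < 2 * r].

(* The cost per unit of lost tree weight: [(2 `^ d) ^+ k] bounds the degree at
   each end of an edge, [160 / eps + 1] the number of points of [Z] charged to
   one shortcut, and each shortcut saves [eps] times the scale. *)
Definition scale_const (d eps : R) (k : nat) : R :=
  2 * (2 `^ d) ^+ k * (160 / eps + 1) / eps.

Lemma scale_const_ge0 (d eps : R) (k : nat) : 0 < eps -> 0 <= scale_const d eps k.
Proof.
move=> eps0; have p0 : 0 <= (2 `^ d) ^+ k by rewrite exprn_ge0// powR_ge0.
have q0 : 0 <= 160 / eps + 1.
  by apply: addr_ge0; [apply: divr_ge0; [exact: ler0n | exact: ltW] | exact: ler01].
apply: divr_ge0; last exact: ltW.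
by apply: mulr_ge0 => //; apply: mulr_ge0 => //; exact: ler0n.
Qed.

Lemma scale_count (d : R) (k : nat) T (eps r r' : R) A rt V par l :
  half_ball_cover X d -> symmetric T -> 0 < eps < 1 -> 0 < r -> 48 / eps <= 2 ^+ k ->
  sorted len_le A -> uniq A -> greedy_edges T (1 + eps) A ->
  (forall x y, near_in (add_edges T A) x y ((1 + eps) * mdist x y)) ->
  tree_in (add_edges T (edges_lt r A)) rt V par l ->
  (forall x, exists2 y, y \in V &
     near_in (add_edges T (edges_lt r A)) x y (eps * r / 32)) ->
  192 / eps * r <= r' ->
  exists V' par' l', [/\ tree_in (add_edges T (edges_lt r' A)) rt V' par' l',
    forall x, exists2 y, y \in V' &
     near_in (add_edges T (edges_lt r' A)) x y (eps * r' / 32),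
    V' \subset V, forall x, x \in V' -> l' x <= Num.max (l x) (3 * r) &
    r * (size (edges_at r A))%:R <= scale_const d eps k *
      ((3 + 2 * #|[set x in V | eps * r / 32 <= l x]%SET|%:R) * (eps * r) +
       64 * (\sum_(x in V) l x - \sum_(x in V') l' x))].
Proof.
move=> hd Tsym eps01 r0 hk sA uA gA span tr cov rr'.
have /andP[eps0 eps1] := eps01.
have er0 : 0 < eps * r by rewrite mulr_gt0.
have er' : 192 * r <= eps * r'.
  have : eps * (192 / eps * r) <= eps * r' by rewrite ler_pM2l.
  by rewrite mulrA [eps * _]mulrC divfK// gt_eqF.
have r2r' : 2 * r <= r'.
  have r'0 : 0 < r'.
    by rewrite -(pmulr_rgt0 _ eps0); apply: lt_le_trans er'; rewrite mulr_gt0.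
  have : eps * r' < r' by rewrite gtr_pMl.
  by lra.
set G := add_edges T (edges_lt r A) in tr cov *.
set H := add_edges T (edges_lt r' A).
have Gsym : symmetric G by exact: add_edges_sym.
have Hsym : symmetric H by exact: add_edges_sym.
have GH : subrel G H.
  apply: add_edges_sub => e; rewrite !mem_filter => /andP[er ->]; rewrite andbT.
  by apply: lt_le_trans er _; lra.
have sc : scale_edges G H eps r (edges_at r A).
  move=> u v; rewrite mem_filter => /andP[/andP[ru ur] uvA]; split=> //.
    rewrite /H /add_edges /= mem_filter uvA (lt_le_trans ur r2r').
    by rewrite orbT.
  exact: (greedy_far sA gA uvA ru).
have [V' [par' [l' [Z [tr' cov' V'V l'l [caught szZ]]]]]] :=
  scale_step Gsym Hsym GH eps01 r0 sc tr cov.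
exists V', par', l'; split=> //.
  move=> x; have [y yV' xy] := cov' x; exists y => //.
  by apply: near_le (near_sub GH xy); lra.
pose P c e := `[< exists b, near_in G (src b e) c (eps * r / 8) >].
have deg c b : (size [seq e <- edges_at r A |
    `[< near_in G (src b e) c (eps * r / 8) >]])%:R <= (2 `^ d) ^+ k :> R.
  apply: (@greedy_degree _ _ _ _ _ _ _ _ _ b c hd Tsym eps01 r0 hk sA gA span).
    by rewrite !filter_uniq.
  move=> e; rewrite mem_filter => /andP[/asboolP ec].
  by rewrite mem_filter => /andP[re eA].
have size_at : (size (edges_at r A))%:R <= (2 `^ d) ^+ k * 2 * (size Z)%:R :> R.
  apply: (size_le_cover (P := P)) => [[u v] /caught[x xuv [c cZ xc]]|c].
    exists c => //; apply/asboolP; case: xuv => xE; rewrite xE in xc.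
      by exists true.
    by exists false.
  apply: (size_le_cover (Z := [:: true; false])
    (P := fun b e => `[< near_in G (src b e) c (eps * r / 8) >])) => [e|b].
    rewrite mem_filter => /andP[/asboolP[b ec] _]; exists b; last exact/asboolP.
    by case: b {ec}.
  apply: le_trans (deg c b); rewrite ler_nat !size_filter count_filter.
  by apply: sub_count => e /andP[].
have kap0 : 0 <= (2 `^ d) ^+ k :> R by rewrite exprn_ge0// powR_ge0.
apply: (@le_trans _ _ (r * ((2 `^ d) ^+ k * 2 * ((160 / eps + 1) *
      (3 + 2 * #|[set x in V | eps * r / 32 <= l x]%SET|%:R +
       64 * (\sum_(x in V) l x - \sum_(x in V') l' x) / (eps * r)))))).
  rewrite ler_pM2l//; apply: (le_trans size_at); apply: ler_wpM2l szZ.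
  exact: mulr_ge0.
rewrite /scale_const; set N := #|_|%:R; set D := _ - _.
set q := 160 / eps + 1; set kap := (2 `^ d) ^+ k.
have e1 : eps * eps^-1 = 1 by rewrite divff// gt_eqF.
have r1 : r * r^-1 = 1 by rewrite divff// gt_eqF.
rewrite invfM.
have -> : r * (kap * 2 * (q * (3 + 2 * N + 64 * D * (eps^-1 * r^-1)))) =
  2 * kap * q * ((3 + 2 * N) * r + 64 * D * eps^-1 * (r * r^-1)) by lra.
have -> : 2 * kap * q / eps * ((3 + 2 * N) * (eps * r) + 64 * D) =
  2 * kap * q * ((3 + 2 * N) * r * (eps * eps^-1) + 64 * D * eps^-1) by lra.
by rewrite e1 r1 !mulr1.
Qed.

Lemma class_sum (d : R) (k n : nat) T (eps r0 th : R) A :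
  half_ball_cover X d -> simple_graph T -> connected_graph T ->
  0 < eps < 1 -> 0 < r0 -> 192 / eps <= th -> 48 / eps <= 2 ^+ k ->
  sorted len_le A -> uniq A -> greedy_edges T (1 + eps) A ->
  (forall x y, near_in (add_edges T A) x y ((1 + eps) * mdist x y)) ->
  (forall i, (i < n)%N -> r0 * th ^+ i <= graph_weight T) ->
  X ->
  \sum_(i < n) r0 * th ^+ i * (size (edges_at (r0 * th ^+ i) A))%:R <=
    198 * scale_const d eps k * graph_weight T.
Proof.
move=> hd Tsimple conn eps01 r00 hth hk sA uA gA span rW rt.
have [Tsym _] := Tsimple; have /andP[eps0 eps1] := eps01.
have [par0 [l0 [tr0 W0]]] := initial_tree rt Tsimple conn.
have th2 : 2 <= th.
  apply: le_trans hth; rewrite ler_pdivlMr//.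
  by have := eps1; lra.
have th0 : 0 < th by apply: lt_le_trans th2.
have pos i : 0 < r0 * th ^+ i by rewrite mulr_gt0// exprn_gt0.
have l00 x : 0 <= l0 x by have [_ _ Vl] := tr0; exact: near_ge0 (Vl x (finset.in_setT x)).
have := scale_const_ge0 d k eps0; set K := scale_const _ _ _ => K0.
pose N i : R := #|[set x | eps * (r0 * th ^+ i) / 32 <= l0 x]%SET|%:R.
have [V [par [l [tr _ _ sumE]]]] : exists V par l,
  [/\ tree_in (add_edges T (edges_lt (r0 * th ^+ n) A)) rt V par l,
    forall x, exists2 y, y \in V &
      near_in (add_edges T (edges_lt (r0 * th ^+ n) A)) x y (eps * (r0 * th ^+ n) / 32),
    forall x, x \in V -> eps * (r0 * th ^+ n) / 32 <= l x -> l x <= l0 x &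
    \sum_(i < n) r0 * th ^+ i * (size (edges_at (r0 * th ^+ i) A))%:R <=
      K * (\sum_(i < n) (3 + 2 * N i) * (eps * (r0 * th ^+ i)) +
           64 * (\sum_(x : X) l0 x - \sum_(x in V) l x))].
  elim: n rW => [|n IH] rW.
    exists [set: X]%SET, par0, l0; split=> //.
    - have [rV lrt Vl] := tr0; split=> // x xV; apply: near_sub (Vl x xV).
      by move=> a b ab; rewrite /add_edges /= ab.
    - move=> x; exists x => //; apply: near_refl.
      by rewrite divr_ge0// mulr_ge0 ?ltW.
    have -> : \sum_(x in [set: X]%SET) l0 x = \sum_(x : X) l0 x.
      by apply: eq_bigl => x; rewrite inE.
    by rewrite !big_ord0 add0r subrr mulr0 mulr0.
  have [|V [par [l [tr cov ll0 sumE]]]] := IH.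
    by move=> i ni; apply: rW; apply: ltnW.
  have thr : 192 / eps * (r0 * th ^+ n) <= r0 * th ^+ n.+1.
    by rewrite exprS [leRHS]mulrCA ler_pM2r.
  have [V' [par' [l' [tr' cov' V'V l'l szE]]]] :=
    scale_count hd Tsym eps01 (pos n) hk sA uA gA span tr cov thr.
  have s6 : 6 * (r0 * th ^+ n) <= eps * (r0 * th ^+ n.+1) / 32.
    have : eps * (192 / eps * (r0 * th ^+ n)) <= eps * (r0 * th ^+ n.+1).
      by rewrite ler_pM2l.
    set rn := r0 * th ^+ n; set rn' := r0 * _.
    by rewrite mulrA [eps * (_ / _)]mulrC divfK ?gt_eqF//; lra.
  exists V', par', l'; split=> //.
    move=> x xV' sl'; have xV := fintype.subsetP V'V _ xV'.
    have := l'l x xV'; rewrite le_max => /orP[l'lx|l'r]; last first.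
      by have := pos n; lra.
    apply: (le_trans l'lx); apply: ll0 => //.
    have : eps * (r0 * th ^+ n) < r0 * th ^+ n by rewrite gtr_pMl.
    by have := pos n; lra.
  rewrite !big_ord_recr /=; apply: (le_trans (lerD sumE szE)).
  rewrite -mulrDr; apply: ler_wpM2l => //.
  have : (3 + 2 * #|[set x in V | eps * (r0 * th ^+ n) / 32 <= l x]%SET|%:R) *
      (eps * (r0 * th ^+ n)) <= (3 + 2 * N n) * (eps * (r0 * th ^+ n)).
    have rn0 : 0 < eps * (r0 * th ^+ n) by rewrite mulr_gt0// pos.
    rewrite ler_pM2r// lerD2l ler_pM2l// ler_nat.
    apply: subset_leq_card; apply/fintype.subsetP => x; rewrite !inE.
    by move=> /andP[xV sx]; apply: (le_trans sx); exact: ll0.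
  set Q := _ * (eps * _); set Q' := (3 + 2 * N n) * _.
  set S1 := \sum_(i < n) (3 + _) * _; set w0 := \sum_(x : X) l0 x.
  by set w1 := \sum_(x in V) l x; set w2 := \sum_(x in V') l' x; lra.
have wV : 0 <= \sum_(x in V) l x.
  by have [_ _ Vl] := tr; apply: sumr_ge0 => x xV; exact: near_ge0 (Vl x xV).
have W00 : 0 <= graph_weight T by apply: le_trans W0; exact: sumr_ge0.
have sum3 : \sum_(i < n) eps * (r0 * th ^+ i) <= 2 * graph_weight T.
  apply: le_trans (geometric_sum_le n r00 th2 W00).
  apply: ler_sum => i _; rewrite rW//.
  by rewrite ger_pMl// ltW.
have sumN : \sum_(i < n) N i * (eps * (r0 * th ^+ i)) <= 64 * graph_weight T.
  apply: (@le_trans _ _ (\sum_(i < n) \sum_(x : X)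
      32 * (if eps / 32 * r0 * th ^+ i <= l0 x then eps / 32 * r0 * th ^+ i else 0))).
    apply: ler_sum => i _; rewrite /N -sum1_card natr_sum mulr_suml.
    rewrite big_mkcond /=; apply: ler_sum => x _; rewrite inE.
    have -> : eps * (r0 * th ^+ i) / 32 = eps / 32 * r0 * th ^+ i by lra.
    by case: ifP => _; lra.
  rewrite exchange_big /=.
  apply: (@le_trans _ _ (\sum_(x : X) 64 * l0 x)).
    apply: ler_sum => x _; rewrite -mulr_sumr.
    have r00' : 0 < eps / 32 * r0 by rewrite mulr_gt0// divr_gt0.
    by have := geometric_sum_le n r00' th2 (l00 x); lra.
  by rewrite -mulr_sumr ler_pM2l.
apply: (le_trans sumE); rewrite [leRHS]mulrAC [leRHS]mulrC.
apply: ler_wpM2l => //.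
have -> : \sum_(i < n) (3 + 2 * N i) * (eps * (r0 * th ^+ i)) =
    3 * \sum_(i < n) eps * (r0 * th ^+ i) + 2 * \sum_(i < n) N i * (eps * (r0 * th ^+ i)).
  by rewrite !mulr_sumr -big_split /=; apply: eq_bigr => i _; lra.
by lra.
Qed.

End ClassSum.

Section LightSpanner.
Context {R : realType}.

Lemma dyadic_bracket (y : R) : 1 <= y ->
  exists m : nat, 2 ^+ m <= y /\ y < 2 ^+ m.+1.
Proof.
move=> y1; have ex : exists n : nat, y < 2 ^+ n.+1.
  exists (Num.truncn y); apply: lt_le_trans (Num.Theory.truncnS_gt y) _.
  by rewrite -natrX ler_nat ltnW// ltn_expl.
case: (ex_minnP ex) => -[|m] ym mmin; first by exists 0%N.
exists m.+1; split=> //; rewrite leNgt; apply/negP => ym'.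
by have := mmin m ym'; rewrite ltnn.
Qed.

Lemma exponent_le_ln (b x : R) (n : nat) : 1 <= b -> 1 <= x ->
  2 ^+ n <= b * x -> n%:R <= (ln b + 1) / ln 2 * (1 + ln x).
Proof.
move=> b1 x1 nbx; have b0 : 0 < b by exact: lt_le_trans b1.
have x0 : 0 < x by exact: lt_le_trans x1.
have ln2 : 0 < ln 2 :> R by rewrite ln_gt0// ltr1n.
rewrite mulrAC ler_pdivlMr//.
have : ln (2 ^+ n) <= ln (b * x) by rewrite ler_ln ?posrE ?exprn_gt0// mulr_gt0.
rewrite lnXn// lnM ?posrE// -mulr_natl => nln.
have : 0 <= ln b * ln x by rewrite mulr_ge0// ln_ge0.
by lra.
Qed.

Context {X : finMetricType R}.
Implicit Types (T : rel X) (A : seq (X * X)) (x y : X).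

Lemma mdist_le_weight T x y : simple_graph T -> connected_graph T ->
  mdist x y <= graph_weight T.
Proof.
move=> Ts conn; have [par [l [[rV lrt Vl] lW]]] := initial_tree y Ts conn.
apply: le_trans lW.
have [_ _ _ reach] := rV; have ex : exists n, iter n par x == y.
  by have [n /eqP] := reach x (finset.in_setT x); exists n.
case: (ex_minnP ex) => n /eqP xn nmin.
have /mdist_near : near_in T x y (chain_weight par l x n).
  rewrite -xn; apply: (near_chain (F := xpredT)) => // z _.
  exact: Vl (finset.in_setT z).
move=> /le_trans; apply.
have inj : {in [set: 'I_n]%SET &, injective (fun i : 'I_n => iter i par x)}.
  have ne (i j : nat) : (i < j)%N -> (j < n)%N -> iter i par x <> iter j par x.
    move=> ij jn E; have iy : iter i par x = y.
      apply: (iter_cycle_root (n := (j - i).-1) rV); first exact: finset.in_setT.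
      by rewrite -iterD prednK ?subn_gt0// subnK// ltnW.
    by have := nmin i; rewrite iy eqxx leqNgt (ltn_trans ij jn) => /(_ isT).
  move=> i j _ _ ij; apply/val_inj/eqP; rewrite eqn_leq; apply/andP.
  by split; rewrite leqNgt; apply/negP => /ne; [move/(_ (ltn_ord i))|move/(_ (ltn_ord j))];
    rewrite /= ?ij; apply.
rewrite /chain_weight (eq_bigl [in [set: 'I_n]%SET]); last by move=> i; rewrite inE.
rewrite -(big_imset l inj) /=; set D := imset _ _.
rewrite [leRHS](bigID [in D])/=.
by rewrite lerDl sumr_ge0// => z _; exact: near_ge0 (Vl z (finset.in_setT z)).
Qed.

Lemma graph_weight_add_edges T A : uniq A ->
  graph_weight (add_edges T A) <= graph_weight T + \sum_(e <- A) edge_len e.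
Proof.
move=> uA; rewrite /graph_weight.
have sumA : \sum_x \sum_(y | (x, y) \in A) mdist x y = \sum_(e <- A) edge_len e.
  rewrite pair_big_dep /= -big_filter (perm_big A)/=; last first.
    apply: uniq_perm => //; first by rewrite filter_uniq// index_enum_uniq.
    by move=> [x y]; rewrite mem_filter mem_index_enum andbT.
  by apply: eq_bigr => -[].
have sumA' : \sum_x \sum_(y | (y, x) \in A) mdist x y = \sum_(e <- A) edge_len e.
  rewrite -sumA (exchange_big_dep xpredT)//=; apply: eq_bigr => x _.
  by apply: eq_bigr => y _; rewrite metric_sym.
have : \sum_x \sum_(y | add_edges T A x y) mdist x y <=
    \sum_x (\sum_(y | T x y) mdist x y + \sum_(y | (x, y) \in A) mdist x y +
            \sum_(y | (y, x) \in A) mdist x y).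
  apply: ler_sum => x _; rewrite big_mkcond [X in X + _ + _]big_mkcond.
  rewrite [X in _ + X + _]big_mkcond [X in _ + _ + X]big_mkcond -!big_split /=.
  apply: ler_sum => y _; have m0 := mdist_ge0 x y; rewrite /add_edges /=.
  by case: (T x y); case: (_ \in A); case: (_ \in A) => /=; lra.
rewrite !big_split /= sumA sumA'.
by lra.
Qed.

Lemma edges_weight_le A (J M : nat) (W : R) : 0 < W -> (0 < J)%N ->
  (forall e, e \in A -> W / 2 ^+ M <= edge_len e <= W) ->
  \sum_(e <- A) edge_len e <=
  \sum_(j < J) \sum_(i < M.+1) 2 * (W / 2 ^+ (J * M.+1).-1 * 2 ^+ j * (2 ^+ J) ^+ i *
    (size (edges_at (W / 2 ^+ (J * M.+1).-1 * 2 ^+ j * (2 ^+ J) ^+ i) A))%:R).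
Proof.
move=> W0 J0 lenA; set N := (J * M.+1).-1.
have JN : (J * M.+1)%N = N.+1 by rewrite prednK// muln_gt0 J0.
have MN : (M <= N)%N by rewrite -ltnS -JN leq_pmull.
have p0 n : 0 < 2 ^+ n :> R by rewrite exprn_gt0.
set r := fun j i : nat => W / 2 ^+ N * 2 ^+ j * (2 ^+ J) ^+ i.
have r0 j i : 0 < r j i by rewrite /r !mulr_gt0 ?invr_gt0// ?exprn_gt0.
pose c (j : 'I_J) (i : 'I_M.+1) (e : X * X) : R :=
  if r j i <= edge_len e < 2 * r j i then 2 * r j i else 0.
have c0 j i e : 0 <= c j i e.
  by rewrite /c; case: ifP => // _; rewrite mulr_ge0// ltW.
apply: (@le_trans _ _ (\sum_(e <- A) \sum_(j < J) \sum_(i < M.+1) c j i e)).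
  rewrite big_seq [leRHS]big_seq; apply: ler_sum => e /lenA /andP[le1 le2].
  have WN0 : 0 < W / 2 ^+ N by rewrite divr_gt0.
  have [|m [my ym]] := @dyadic_bracket (edge_len e / (W / 2 ^+ N)).
    rewrite ler_pdivlMr// mul1r; apply: le_trans le1.
    by rewrite ler_pM2l// lef_pV2 ?posrE// ler_eXn2l// ltr1n.
  move: my ym; rewrite ler_pdivlMr// ltr_pdivrMr// => my ym.
  have mN : (m < J * M.+1)%N.
    rewrite JN ltnS -(@ler_eXn2l R 2) ?ltr1n//.
    by rewrite -(ler_pM2r WN0) (le_trans my)// mulrC divfK.
  have mJ : (m %% J < J)%N by rewrite ltn_mod.
  have mM : (m %/ J < M.+1)%N by rewrite ltn_divLR// mulnC.
  rewrite (bigD1 (Ordinal mJ))//= (bigD1 (Ordinal mM))//=.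
  have rm : r (m %% J)%N (m %/ J)%N = 2 ^+ m * (W / 2 ^+ N).
    rewrite /r -mulrA -exprM -exprD mulrC; congr (2 ^+ _ * _).
    by rewrite addnC mulnC -divn_eq.
  rewrite -addrA; apply: ler_wpDr.
    by rewrite addr_ge0// !sumr_ge0// => j _; rewrite sumr_ge0.
  rewrite /c /= rm my /=; move: ym; rewrite exprS -mulrA => ym.
  by rewrite ym ltW.
rewrite exchange_big /=; apply: ler_sum => j _; rewrite exchange_big /=.
apply: ler_sum => i _; rewrite -big_mkcond /= big_const_seq iter_addr_0.
by rewrite -/(r j i) /edges_at size_filter mulrA mulr_natr.
Qed.

End LightSpanner.

Lemma spanner_lightness (R : realType) (X : finMetricType R) (d eps : R)
    (J k : nat) :
  half_ball_cover X d -> 0 < eps < 1 -> X ->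
  192 / eps <= 2 ^+ J -> 48 / eps <= 2 ^+ k ->
  exists S : rel X, is_spanner (1 + eps) S /\
    lightness S <= 1 + J%:R * (396 * scale_const d eps k).
Proof.
move=> hd eps01 x0 hJ hk; have /andP[eps0 eps1] := eps01.
have [T [[Ts conn _] WE _]] := mst_weight_attained x0.
have [Tsym Tirr] := Ts.
have t1 : 1 <= 1 + eps by rewrite lerDl ltW.
have tot : total (@len_le R X) by move=> e f; exact: le_total.
have [A [AL gA cov]] := greedy_exists T (sort (@len_le R X) (enum {: X * X})) t1.
have sA : sorted (@len_le R X) A.
  apply: subseq_sorted AL (sort_sorted tot _).
  by move=> ? ? ? /=; exact: le_trans.
have uA : uniq A by apply: subseq_uniq AL _; rewrite sort_uniq enum_uniq.
have span x y : near_in (add_edges T A) x y ((1 + eps) * mdist x y).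
  by apply: (cov (x, y)); rewrite mem_sort mem_enum.
have nloop e : e \in A -> e.1 != e.2.
  move=> eA; apply/eqP => e12; have := greedy_far sA gA eA (lexx _); apply.
  rewrite e12; apply: near_refl; apply: mulr_ge0 (mdist_ge0 _ _).
  exact: le_trans ler01 t1.
exists (add_edges T A); split.
  split=> [|x y]; last exact: near_graph_dist.
  split; first exact: add_edges_sym.
  move=> x; apply/negP => /or3P[|/nloop|/nloop]; last 2 first.
  - by rewrite eqxx.
  - by rewrite eqxx.
  by rewrite Tirr.
have := scale_const_ge0 d k eps0; set K := scale_const _ _ _ => K0.
rewrite /lightness WE; set W := graph_weight T.
have W0 : 0 <= W.
  apply: mulr_ge0; first by rewrite invr_ge0 ler0n.
  by apply: sumr_ge0 => x _; apply: sumr_ge0 => y _; exact: mdist_ge0.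
have [W00|Wpos] := eqVneq W 0.
  rewrite W00 invr0 mulr0; apply: addr_ge0; first exact: ler01.
  apply: mulr_ge0; first exact: ler0n.
  by apply: mulr_ge0; [exact: ler0n | exact: K0].
have {Wpos}Wpos : 0 < W by rewrite lt_neqAle eq_sym Wpos.
rewrite ler_pdivrMr//; apply: (le_trans (graph_weight_add_edges T uA)).
rewrite mulrDl mul1r lerD2l.
have Jpos : (0 < J)%N.
  rewrite lt0n; apply/eqP => J0; move: hJ; rewrite J0 expr0 ler_pdivrMr// mul1r.
  by lra.
have [M lenM] : exists M : nat, forall e, e \in A -> W / 2 ^+ M <= edge_len e.
  have /boolp.choice[f fP] (e : X * X) : exists m : nat, e \in A -> W / 2 ^+ m <= edge_len e.
    have [eA|] := boolP (e \in A); last by exists 0%N.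
    have e0 : 0 < edge_len e by rewrite mdist_gt0 nloop.
    have [|m [_ lem]] := @dyadic_bracket R (W / edge_len e).
      by rewrite ler_pdivlMr// mul1r mdist_le_weight.
    exists m.+1 => _; rewrite ler_pdivrMr ?exprn_gt0// mulrC -ler_pdivrMr//.
    exact: ltW.
  exists (\max_(e <- A) f e)%N => e eA; apply: le_trans (fP e eA).
  rewrite ler_pM2l// lef_pV2 ?posrE ?exprn_gt0// ler_eXn2l ?ltr1n//.
  exact: leq_bigmax_seq.
apply: (le_trans (edges_weight_le (M := M) Wpos Jpos _)) => [e eA|].
  by rewrite lenM// mdist_le_weight.
set r0 := W / _.
have r00 : 0 < r0 by rewrite divr_gt0// exprn_gt0.
have th j : (j < J)%N ->
    \sum_(i < M.+1) r0 * 2 ^+ j * (2 ^+ J) ^+ i *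
      (size (edges_at (r0 * 2 ^+ j * (2 ^+ J) ^+ i) A))%:R <= 198 * K * W.
  move=> jJ; apply: (class_sum hd Ts conn) => //.
    by rewrite mulr_gt0// exprn_gt0.
  move=> i iM; rewrite -mulrA -exprM -exprD /r0 -mulrA ger_pMr//.
  rewrite mulrC ler_pdivrMr ?exprn_gt0// mul1r ler_eXn2l ?ltr1n//.
  rewrite -ltnS prednK ?muln_gt0 ?Jpos//.
  apply: (@leq_trans (J + J * i)%N); first by rewrite ltn_add2r.
  by rewrite -mulnS leq_mul2l iM orbT.
apply: (@le_trans _ _ (\sum_(j < J) 2 * (198 * K * W))).
  by apply: ler_sum => j _; rewrite -mulr_sumr ler_pM2l// th.
by rewrite sumr_const card_ord -mulr_natl; lra.
Qed.

(* The logarithmic factor is 1 + ln(1/eps), as ln(1/eps) alone vanishes when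
   eps tends to 1 whereas the lightness of a spanner is at least 1. *)
Theorem theorem5 (R : realType) (d : R) (hd : 1 <= d) :
  exists C : R, forall (eps : R), 0 < eps -> eps < 1 ->
    forall X : finMetricType R, doubling_dimension X d ->
      exists S : rel X, is_spanner (1 + eps) S /\
        lightness S <= C * eps `^ (- (d + 2)) * (1 + ln (eps^-1)).
Proof.
have ln2 : 0 < ln 2 :> R by rewrite ln_gt0// ltr1n.
have ln384 : 0 <= ln 384 :> R by rewrite ln_ge0// ler1n.
pose c := (ln 384 + 1) / ln 2 : R.
have c0 : 0 <= c by rewrite divr_ge0// ?addr_ge0// ltW.
exists (1 + 396 * (322 * (c * 96 `^ d))) => eps eps0 eps1 X [cover _].
have eps01 : 0 < eps < 1 by rewrite eps0.
have ie1 : 1 <= eps^-1 by rewrite invf_ge1// ltW.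
have lnie : 0 <= ln eps^-1 by exact: ln_ge0.
have d0 : 0 <= d by apply: le_trans hd.
have pE : eps `^ (- (d + 2)) = eps^-1 `^ d * eps^-1 ^+ 2.
  have -> : eps^-1 `^ d = (eps `^ d)^-1.
    by rewrite -(powR_inv1 (ltW eps0)) -powRrM mulN1r powRN.
  have e0 : eps != 0 by rewrite gt_eqF.
  rewrite powRN powRD; last by rewrite e0 implybT.
  rewrite invfM exprVn.
  by rewrite (powR_mulrn 2 (ltW eps0)).
have p1 : 1 <= eps^-1 `^ d.
  by rewrite -(powRr0 eps^-1); exact: ler_powR.
have pe : 1 <= eps^-1 `^ d * eps^-1 ^+ 2.
  by rewrite -[1]mulr1 ler_pM// exprn_ege1.
set p := eps `^ (- (d + 2)) in pE *.
have [[x0]|noX] := pselect (inhabited X); last first.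
  exists (fun _ _ => false); split.
    split; first by split=> // x; case: noX; constructor.
    by move=> x; case: noX; constructor.
  rewrite /lightness /graph_weight big1 ?mulr0 ?mul0r; last first.
    by move=> x; case: noX; constructor.
  have A0 : 0 <= 96 `^ d :> R by exact: powR_ge0.
  apply: mulr_ge0; last exact: addr_ge0.
  apply: mulr_ge0; last by rewrite pE; exact: le_trans ler01 pe.
  apply: addr_ge0; first exact: ler01.
  apply: mulr_ge0; first exact: ler0n.
  apply: mulr_ge0; first exact: ler0n.
  exact: mulr_ge0.
have bracket (y : R) : 1 <= y -> exists2 m : nat, y <= 2 ^+ m & 2 ^+ m <= 2 * y.
  move=> /dyadic_bracket[m [my ym]]; exists m.+1; first exact: ltW.
  by rewrite exprS ler_pM2l.
have [|J hJ Jh] := bracket (192 / eps); first by lra.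
have [|k hk kh] := bracket (48 / eps); first by lra.
have [S [spanS lightS]] := spanner_lightness cover eps01 x0 hJ hk.
exists S; split=> //; apply: (le_trans lightS).
rewrite pE; set l := ln eps^-1 in lnie *; set p' := eps^-1 `^ d * eps^-1 ^+ 2 in pe *.
have powk : (2 `^ d) ^+ k <= 96 `^ d * eps^-1 `^ d.
  rewrite -powR_mulrn ?powR_ge0// powRAC powR_mulrn//.
  rewrite -powRM//; last by apply: le_trans ie1.
  apply: ge0_ler_powR; rewrite ?nnegrE//.
    by apply: mulr_ge0 (ler0n _ _) _; apply: le_trans ie1.
  by apply: (le_trans kh); lra.
have boundq : (160 / eps + 1) / eps <= 161 * eps^-1 ^+ 2.
  rewrite expr2 mulrA ler_pM2r ?invr_gt0//.
  by lra.
have boundJ : J%:R <= c * (1 + l).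
  apply: exponent_le_ln => //; first by rewrite ler1n.
  by apply: (le_trans Jh); lra.
have boundK : scale_const d eps k <= 322 * 96 `^ d * p'.
  apply: (@le_trans _ _ (2 * (96 `^ d * eps^-1 `^ d) * (161 * eps^-1 ^+ 2))).
    rewrite /scale_const -[leLHS]mulrA; apply: ler_pM => //.
    - apply: divr_ge0 (ltW eps0); apply: addr_ge0 ler01.
      by apply: divr_ge0 (ltW eps0); exact: ler0n.
    - by rewrite ler_pM2l.
  by rewrite /p'; lra.
have JK : J%:R * (396 * scale_const d eps k) <=
    c * (1 + l) * (396 * (322 * 96 `^ d * p')).
  have c396 : 0 <= 396 * scale_const d eps k.
    by apply: mulr_ge0; [exact: ler0n | exact: scale_const_ge0].
  apply: (ler_pM _ c396 boundJ); first exact: ler0n.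
  by apply: ler_wpM2l boundK; exact: ler0n.
have : 1 * 1 <= p' * (1 + l) by rewrite ler_pM// lerDl.
by lra.
Qed.
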